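(* Let $n\ge 4$ be an integer, let $l,r$ be indeterminates, $F=\mathbb Q(l,r)$ and $m=\frac1r-r$. Let $V_n$ be the $F$-vector space with basis $\{w_{ij},\widehat{w_{ij}}: 1\le i<j\le n\}$. Define $F$-linear endomorphisms $\nu_1,\dots,\nu_n$ of $V_n$ as follows, where $\overline{w_{s,t}}$ stands for either $w_{s,t}$ or $\widehat{w_{s,t}}$ (the same choice on both sides of an equation). Action of $\nu_1$: for $3\le i<j\le n$, $$\begin{aligned}\nu_1(\widehat{w_{ij}})=\;&m r^{j-5}(\widehat{w_{1,i}}-w_{1,i})+m r^{j-4}(\widehat{w_{2,i}}-w_{2,i})+m r^{i-3}(\widehat{w_{1,j}}-w_{1,j})+m r^{i-2}(\widehat{w_{2,j}}-w_{2,j})\\&+m^2(r^{i+j-8}+r^{i+j-6})(\widehat{w_{12}}-w_{12})+r\,\widehat{w_{ij}};\end{aligned}$$ for $3\le j\le n$, $$\nu_1(\widehat{w_{1j}})=w_{2j},\qquad \nu_1(\widehat{w_{2j}})=w_{1j}+m r^{j-3}w_{12}-m\,w_{2j},\qquad \nu_1(w_{2j})=\widehat{w_{1j}}+m r^{j-3}\widehat{w_{12}}-m\,w_{2j},$$ $$\nu_1(w_{1j})=\widehat{w_{2j}}+m r^{j-4}(\widehat{w_{12}}-w_{12})+m(\widehat{w_{1j}}-w_{1j});$$ $\nu_1(\widehat{w_{12}})=\frac1l\widehat{w_{12}}$; and $\nu_1(\overline{w_{s,t}})=r\,\overline{w_{s,t}}$ for all other basis vectors. Action of $\nu_k$, $2\le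 k\le n$: $\nu_k(\overline{w_{k-1,t}})=\overline{w_{k,t}}$ for $k+1\le t\le n$; $\nu_k(\overline{w_{s,k-1}})=\overline{w_{s,k}}$ for $1\le s\le k-2$; $\nu_k(\widehat{w_{k-1,k}})=r\,\widehat{w_{k-1,k}}$; $\nu_k(w_{k-1,k})=\frac1l w_{k-1,k}$; for $k+1\le t\le n$, $\nu_k(\widehat{w_{k,t}})=\widehat{w_{k-1,t}}+\frac ml r^{t-k-2}w_{k-1,k}-m\,\widehat{w_{k,t}}$ and $\nu_k(w_{k,t})=w_{k-1,t}+m r^{t-k-1}w_{k-1,k}-m\,w_{k,t}$; for $1\le s\le k-2$, $\nu_k(\overline{w_{s,k}})=\overline{w_{s,k-1}}+\frac{m}{l\,r^{k-s-2}}w_{k-1,k}-m\,\overline{w_{s,k}}$; and $\nu_k(\overline{w_{s,t}})=r\,\overline{w_{s,t}}$ for all other basis vectors. Then $g_i\mapsto\nu_i$ ($1\le i\le n$) defines a representation $\nu^{(n)}:\mathcal{CGW}(D_n)\to\mathrm{End}_F(V_n)$ of the CGW algebra of type $D_n$ with parameters $l$ and $m$. Moreover, as a representation of the Artin group of type $D_n$, up to the change of parameters $l=r^3t^{-1}$ and up to some rescaling of the generators (multiplication of the images of the generators by a common nonzero scalar), this representation is equivalent to the Cohen--Wales representation with parameters $t$ and $r$.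
   Context: Number the nodes of the Dynkin diagram of type $D_n$ by $1,\dots,n$ so that node $1$ is adjacent to node $3$ only and, for $2\le i\le n-1$, node $i$ is adjacent to node $i+1$ (these are all adjacencies); write $i\sim j$ for adjacent nodes. The Artin group of type $D_n$ has generators $g_1,\dots,g_n$ and relations $g_ig_jg_i=g_jg_ig_j$ if $i\sim j$, $g_ig_j=g_jg_i$ if $i\ne j$, $i\not\sim j$. The CGW (Cohen--Gijsbers--Wales) algebra $\mathcal{CGW}(D_n)$ with parameters $l,m$ is the unital associative $F$-algebra generated by $g_1,\dots,g_n,e_1,\dots,e_n$ subject to the relations $g_ig_jg_i=g_jg_ig_j$ if $i\sim j$ and $g_ig_j=g_jg_i$ if $i\ne j$, $i\not\sim j$, the relations $m\,e_i=l(g_i^2+m\,g_i-1)$ and $g_ie_i=\frac1l e_i$ for all $i$, and $e_ig_je_i=l\,e_i$ when $i\sim j$. Cohen--Wales representation. Let $\Phi^+$ be the set of the $n^2-n$ positive roots of a root system of type $D_n$ with simple roots $\alpha_1,\dots,\alpha_n$ and inner product normalized by $(\alpha,\alpha)=2$ for all roots. Let $V$ be a vector space with basis $(x_\beta)_{\beta\in\Phi^+}$. For a parameter $\rho$ let $\tau_k$ be the linear map with $\tau_k(x_\beta)=0$ if $\beta=\alpha_k$; $\tau_k(x_\beta)=\rho\,x_{\beta-\alpha_k}$ if $(\alpha_k,\beta)=1$; $\tau_k(x_\beta)=x_\beta$ if $(\alpha_k,\beta)=0$; $\tau_k(x_\beta)=(1-\rho^2)x_\beta+\rho\,x_{\beta+\alpha_k}$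 if $(\alpha_k,\beta)=-1$. For $\rho,t$ indeterminates there is a unique family $T_{k,\beta}\in\mathbb Z[\rho^{\pm1}]$ with $T_{k,\alpha_k}=\rho^4$ for all $k$ such that, with $T_k(x_\beta)=T_{k,\beta}x_{\alpha_k}$, the maps $\sigma_k=\tau_k+tT_k$ satisfy the defining relations of the Artin group. In the convention used here, the Cohen--Wales representation with parameters $t$ and $r$ is $g_k\mapsto\sigma_k$ with $\rho=r^{-1}$ (the parameter $r$ here is the inverse of the one in the original construction), over the field $\mathbb Q(t,r)=\mathbb Q(l,r)$. *)

(* Defs.v *)
From HB Require Import structures.
From mathcomp Require Import all_boot all_order all_algebra generic_quotient.
From mathcomp Require Import boolp classical_sets.

Set Implicit Arguments.
Unset Strict Implicit.
Unset Printing Implicit Defensive.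

Import GRing.Theory.
Local Open Scope ring_scope.
Local Open Scope quotient_scope.

(* Node k of the diagram (1 <= k <= n) is represented by the i : 'I_n with
   k = i.+1; every nat occurring below as a node or as an index of a basis
   vector is such a label, counted from 1. *)
Definition Dn_adj (a b : nat) : bool :=
  let edge (a b : nat) :=
    ((a == 1) && (b == 3) || (2 <= a) && (b == a.+1))%N in
  edge a b || edge b a.

Definition artin_rel (n : nat) (T : Type) (mul : T -> T -> T)
    (g : 'I_n -> T) : Prop :=
  (forall i j : 'I_n, Dn_adj i.+1 j.+1 ->
     mul (mul (g i) (g j)) (g i) = mul (mul (g j) (g i)) (g j)) /\
  (forall i j : 'I_n, i != j -> ~~ Dn_adj i.+1 j.+1 ->
     mul (g i) (g j) = mul (g j) (g i)).

(* The Artin group is presented as formal group words modulo equality in every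
   group equipped with a family satisfying the relations. *)
Section Artin.
Variable n : nat.

Inductive artin_word : Type :=
  | AGen of 'I_n | AOne | AMul of artin_word & artin_word | AInv of artin_word.

HB.instance Definition _ := gen_eqMixin artin_word.
HB.instance Definition _ := gen_choiceMixin artin_word.

Fixpoint artin_eval (G : groupType) (s : 'I_n -> G) (w : artin_word) : G :=
  match w with
  | AGen i => s i
  | AOne => 1%g
  | AMul u v => (artin_eval s u * artin_eval s v)%g
  | AInv u => ((artin_eval s u)^-1)%g
  end.

Definition artin_eqv : rel artin_word := fun u v =>
  `[< forall (G : groupType) (s : 'I_n -> G),
        artin_rel (fun x y => x * y)%g s -> artin_eval s u = artin_eval s v >].

Lemma artin_eqv_refl : reflexive artin_eqv.
Proof. by move=> u; apply/asboolP. Qed.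

Lemma artin_eqv_sym : symmetric artin_eqv.
Proof.
by move=> u v; apply/asboolP/asboolP => H G s Hs; rewrite (H G s Hs).
Qed.

Lemma artin_eqv_trans : transitive artin_eqv.
Proof.
move=> v u w /asboolP Huv /asboolP Hvw; apply/asboolP => G s Hs.
by rewrite (Huv G s Hs) (Hvw G s Hs).
Qed.

Canonical artin_equiv :=
  EquivRel artin_eqv artin_eqv_refl artin_eqv_sym artin_eqv_trans.

Definition artin := {eq_quot artin_equiv}.
HB.instance Definition _ := Choice.on artin.

Lemma artin_eqP (u v : artin_word) :
  (forall (G : groupType) (s : 'I_n -> G),
     artin_rel (fun x y => x * y)%g s -> artin_eval s u = artin_eval s v) <->
  \pi_artin u = \pi_artin v.
Proof.
split=> [H|/eqP]; first by apply/eqP; rewrite eqmodE /=; apply/asboolP.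
by rewrite eqmodE /= => /asboolP.
Qed.

Lemma artin_reprE (G : groupType) (s : 'I_n -> G) (w : artin_word) :
  artin_rel (fun x y => x * y)%g s ->
  artin_eval s (repr (\pi_artin w)) = artin_eval s w.
Proof. by apply: (proj2 (artin_eqP _ _)); rewrite reprK. Qed.

Definition artin_one : artin := \pi_artin AOne.
Definition artin_mul (x y : artin) : artin := \pi_artin (AMul (repr x) (repr y)).
Definition artin_inv (x : artin) : artin := \pi_artin (AInv (repr x)).

Fact artin_mulA : associative artin_mul.
Proof.
move=> x y z; apply/artin_eqP => G s Hs /=.
by rewrite !artin_reprE //= mulgA.
Qed.

Fact artin_mul1 : left_id artin_one artin_mul.
Proof.
move=> x; rewrite -[RHS]reprK; apply/artin_eqP => G s Hs /=.
by rewrite artin_reprE //= mul1g.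
Qed.

Fact artin_mulr1 : right_id artin_one artin_mul.
Proof.
move=> x; rewrite -[RHS]reprK; apply/artin_eqP => G s Hs /=.
by rewrite artin_reprE //= mulg1.
Qed.

Fact artin_mulV : left_inverse artin_one artin_inv artin_mul.
Proof.
move=> x; apply/artin_eqP => G s Hs /=.
by rewrite artin_reprE //= mulVg.
Qed.

Fact artin_mulrV : right_inverse artin_one artin_inv artin_mul.
Proof.
move=> x; apply/artin_eqP => G s Hs /=.
by rewrite artin_reprE //= mulgV.
Qed.

HB.instance Definition _ := isGroup.Build artin
  artin_mulA artin_mul1 artin_mulr1 artin_mulV artin_mulrV.

Definition artin_gen (i : 'I_n) : artin := \pi_artin (AGen i).

Lemma artin_gen_rel : artin_rel (fun x y => x * y)%g artin_gen.
Proof.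
by split=> [i j ij | i j ij nij]; apply/artin_eqP => G s Hs /=;
  do !rewrite artin_reprE //=; case: Hs => Hb Hc; [apply: Hb | apply: Hc].
Qed.

Lemma artin_lift (G : groupType) (s : 'I_n -> G) :
  artin_rel (fun x y => x * y)%g s ->
  exists f : artin -> G,
    (forall x y, f (x * y)%g = (f x * f y)%g) /\ (forall i, f (artin_gen i) = s i).
Proof.
move=> Hs; exists (fun x => artin_eval s (repr x)).
by split=> *; rewrite artin_reprE.
Qed.

End Artin.

(* The CGW algebra, presented in the same way. An F-algebra is taken here as a
   ring A with a ring morphism s : F -> A of central image, because the
   library's algType excludes the zero ring. *)
Section CGW.
Variables (F : fieldType) (n : nat) (l m : F).

Definition cgw_rel (A : pzRingType) (s : {rmorphism F -> A})
    (g e : 'I_n -> A) : Prop :=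
  [/\ forall c x, s c * x = x * s c,
      artin_rel *%R g,
      forall i, s m * e i = s l * (g i ^+ 2 + s m * g i - 1),
      forall i, g i * e i = s l^-1 * e i &
      forall i j : 'I_n, Dn_adj i.+1 j.+1 -> e i * g j * e i = s l * e i].

Inductive cgw_term : Type :=
  | CG of 'I_n | CE of 'I_n | CScal of F
  | CAdd of cgw_term & cgw_term | CMul of cgw_term & cgw_term.

HB.instance Definition _ := gen_eqMixin cgw_term.
HB.instance Definition _ := gen_choiceMixin cgw_term.

Fixpoint cgw_eval (A : pzRingType) (s : {rmorphism F -> A}) (g e : 'I_n -> A)
    (u : cgw_term) : A :=
  match u with
  | CG i => g i
  | CE i => e i
  | CScal c => s c
  | CAdd u v => cgw_eval s g e u + cgw_eval s g e v
  | CMul u v => cgw_eval s g e u * cgw_eval s g e v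
  end.

Definition cgw_eqv : rel cgw_term := fun u v =>
  `[< forall (A : pzRingType) (s : {rmorphism F -> A}) (g e : 'I_n -> A),
        cgw_rel s g e -> cgw_eval s g e u = cgw_eval s g e v >].

Lemma cgw_eqv_refl : reflexive cgw_eqv.
Proof. by move=> u; apply/asboolP. Qed.

Lemma cgw_eqv_sym : symmetric cgw_eqv.
Proof.
by move=> u v; apply/asboolP/asboolP => H A s g e Hr; rewrite (H A s g e Hr).
Qed.

Lemma cgw_eqv_trans : transitive cgw_eqv.
Proof.
move=> v u w /asboolP Huv /asboolP Hvw; apply/asboolP => A s g e Hr.
by rewrite (Huv A s g e Hr) (Hvw A s g e Hr).
Qed.

Canonical cgw_equiv := EquivRel cgw_eqv cgw_eqv_refl cgw_eqv_sym cgw_eqv_trans.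

Definition CGW := {eq_quot cgw_equiv}.
HB.instance Definition _ := Choice.on CGW.

Lemma cgw_eqP (u v : cgw_term) :
  (forall (A : pzRingType) (s : {rmorphism F -> A}) (g e : 'I_n -> A),
     cgw_rel s g e -> cgw_eval s g e u = cgw_eval s g e v) <->
  \pi_CGW u = \pi_CGW v.
Proof.
split=> [H|/eqP]; first by apply/eqP; rewrite eqmodE /=; apply/asboolP.
by rewrite eqmodE /= => /asboolP.
Qed.

Lemma cgw_reprE (A : pzRingType) (s : {rmorphism F -> A}) (g e : 'I_n -> A)
    (u : cgw_term) :
  cgw_rel s g e -> cgw_eval s g e (repr (\pi_CGW u)) = cgw_eval s g e u.
Proof. by apply: (proj2 (cgw_eqP _ _)); rewrite reprK. Qed.

Definition cgw_scal (c : F) : CGW := \pi_CGW (CScal c).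
Definition cgw_add (x y : CGW) : CGW := \pi_CGW (CAdd (repr x) (repr y)).
Definition cgw_mul (x y : CGW) : CGW := \pi_CGW (CMul (repr x) (repr y)).
Definition cgw_opp (x : CGW) : CGW := cgw_mul (cgw_scal (-1)) x.
Definition cgw_scale (c : F) (x : CGW) : CGW := cgw_mul (cgw_scal c) x.

Local Ltac cgw_tac := rewrite -[RHS]reprK; apply/cgw_eqP => A s g e Hr /=;
  repeat (rewrite cgw_reprE //=).

Fact cgw_addA : associative cgw_add. Proof. by move=> x y z; cgw_tac; rewrite addrA. Qed.
Fact cgw_addC : commutative cgw_add. Proof. by move=> ? ?; cgw_tac; rewrite addrC. Qed.
Fact cgw_add0 : left_id (cgw_scal 0) cgw_add.
Proof. by move=> x; cgw_tac; rewrite rmorph0 add0r. Qed.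
Fact cgw_addN : left_inverse (cgw_scal 0) cgw_opp cgw_add.
Proof. by move=> x; cgw_tac; rewrite rmorph0 rmorphN1 mulN1r addNr. Qed.

HB.instance Definition _ := GRing.isZmodule.Build CGW
  cgw_addA cgw_addC cgw_add0 cgw_addN.

Fact cgw_mulA : associative cgw_mul.
Proof. by move=> x y z; cgw_tac; rewrite mulrA. Qed.
Fact cgw_mul1 : left_id (cgw_scal 1) cgw_mul.
Proof. by move=> x; cgw_tac; rewrite rmorph1 mul1r. Qed.
Fact cgw_mulr1 : right_id (cgw_scal 1) cgw_mul.
Proof. by move=> x; cgw_tac; rewrite rmorph1 mulr1. Qed.
Fact cgw_mulDl : left_distributive cgw_mul +%R.
Proof. by move=> x y z; cgw_tac; rewrite mulrDl. Qed.
Fact cgw_mulDr : right_distributive cgw_mul +%R.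
Proof. by move=> x y z; cgw_tac; rewrite mulrDr. Qed.

HB.instance Definition _ := GRing.Zmodule_isPzRing.Build CGW
  cgw_mulA cgw_mul1 cgw_mulr1 cgw_mulDl cgw_mulDr.

Fact cgw_scaleA a b (x : CGW) : cgw_scale a (cgw_scale b x) = cgw_scale (a * b) x.
Proof. by cgw_tac; rewrite rmorphM mulrA. Qed.
Fact cgw_scale1 : left_id 1 cgw_scale.
Proof. exact: cgw_mul1. Qed.
Fact cgw_scaleDr : right_distributive cgw_scale +%R.
Proof. by move=> a x y; apply: cgw_mulDr. Qed.
Fact cgw_scaleDl (x : CGW) : {morph cgw_scale^~ x : a b / a + b}.
Proof. by move=> a b /=; cgw_tac; rewrite rmorphD mulrDl. Qed.

HB.instance Definition _ := GRing.Zmodule_isLmodule.Build F CGW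
  cgw_scaleA cgw_scale1 cgw_scaleDr cgw_scaleDl.

Fact cgw_scaleAl (a : F) (x y : CGW) : a *: (x * y) = (a *: x) * y.
Proof. exact: cgw_mulA. Qed.
Fact cgw_scaleAr (a : F) (x y : CGW) : a *: (x * y) = x * (a *: y).
Proof. by cgw_tac; case: Hr => sC _ _ _ _; rewrite !mulrA sC. Qed.

Definition cgw_g (i : 'I_n) : CGW := \pi_CGW (CG i).
Definition cgw_e (i : 'I_n) : CGW := \pi_CGW (CE i).

Fact cgw_scal_is_zmod : zmod_morphism cgw_scal.
Proof. by move=> a b; cgw_tac; rewrite rmorphB rmorphN1 mulN1r. Qed.
Fact cgw_scal_is_monoid : monoid_morphism cgw_scal.
Proof. by split=> // a b; cgw_tac; rewrite rmorphM. Qed.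

HB.instance Definition _ := GRing.isZmodMorphism.Build F CGW cgw_scal cgw_scal_is_zmod.
HB.instance Definition _ := GRing.isMonoidMorphism.Build F CGW cgw_scal cgw_scal_is_monoid.

Lemma cgw_gen_rel : cgw_rel cgw_scal cgw_g cgw_e.
Proof.
split=> [c x | | i | i | i j ij].
- by cgw_tac; case: Hr.
- split=> [i j ij | i j ij nij]; cgw_tac; case: Hr => _ [Hb Hc] _ _ _.
    exact: Hb.
  exact: Hc.
- by cgw_tac; case: Hr => _ _ He _ _; rewrite rmorphN1 mulN1r rmorph1 -expr2.
- by cgw_tac; case: Hr.
- by cgw_tac; case: Hr => _ _ _ _; apply.
Qed.

Lemma cgw_lift (A : pzRingType) (s : {rmorphism F -> A}) (g e : 'I_n -> A) :
  cgw_rel s g e ->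
  exists f : {rmorphism CGW -> A},
    [/\ forall c x, f (c *: x) = s c * f x,
        forall i, f (cgw_g i) = g i & forall i, f (cgw_e i) = e i].
Proof.
move=> Hr; pose f (x : CGW) := cgw_eval s g e (repr x).
have fB : zmod_morphism f.
  move=> x y; rewrite /f; do !rewrite cgw_reprE //=.
  by rewrite rmorphN1 mulN1r.
have fM : monoid_morphism f.
  by split=> [|x y]; rewrite /f cgw_reprE //=; apply: rmorph1.
pose fZ := GRing.isZmodMorphism.Build _ _ f fB.
pose fR := GRing.isMonoidMorphism.Build _ _ f fM.
pose F' : {rmorphism CGW -> A} := HB.pack f fZ fR.
by exists F'; split=> *; rewrite /= /f; do !rewrite cgw_reprE //=.
Qed.

End CGW.


Definition endo (F : fieldType) (V : vectType F) : Type := 'End(V).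

Section Endo.
Variables (F : fieldType) (V : vectType F).

HB.instance Definition _ := GRing.Lmodule.on (endo V).
HB.instance Definition _ := GRing.Zmodule_isPzRing.Build (endo V)
  (@comp_lfunA F V V V V) (@comp_lfun1l F V V) (@comp_lfun1r F V V)
  (@comp_lfunDl F V V V) (@comp_lfunDr F V V V).

End Endo.

Definition group_rep (G : groupType) (F : fieldType) (V : vectType F)
    (R : G -> endo V) : Prop :=
  R 1%g = 1 /\ forall x y : G, R (x * y)%g = R x * R y.

Definition rep_equiv (G : groupType) (F : fieldType) (V W : vectType F)
    (R : G -> endo V) (S : G -> endo W) : Prop :=
  exists phi : 'Hom(V, W),
    bijective phi /\ forall x, (phi \o R x)%VF = (S x \o phi)%VF.

(* An index stands for a pair i < j of labels, together with a flag: for V_n,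
   (i, j, true) indexes \widehat{w_ij} and (i, j, false) indexes w_ij; for the
   positive roots, they stand for eps_j + eps_i and eps_j - eps_i. *)
Definition Dn_idx (n : nat) : Type :=
  ({p : 'I_n * 'I_n | (p.1 < p.2)%N} * bool)%type.
HB.instance Definition _ n := Finite.on (Dn_idx n).

Definition lo n (b : Dn_idx n) : nat := (val b.1).1.+1.
Definition hi n (b : Dn_idx n) : nat := (val b.1).2.+1.
Definition flag n (b : Dn_idx n) : bool := b.2.

Definition Dn_space (F : fieldType) (n : nat) : vectType F :=
  {ffun Dn_idx n -> F^o}.

Definition linext (F : fieldType) (n : nat) (f : Dn_idx n -> Dn_space F n) :
    endo (Dn_space F n) :=
  linfun (fun v : Dn_space F n => \sum_b v b *: f b).

Lemma linextE (F : fieldType) (n : nat) (f : Dn_idx n -> Dn_space F n) b :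
  (linext f : 'End(Dn_space F n)) [ffun c => (c == b)%:R] = f b.
Proof.
pose g (v : Dn_space F n) := \sum_b v b *: f b.
have g_lin : linear g.
  move=> a u v; rewrite /g scaler_sumr -big_split /=; apply: eq_bigr => c _.
  by rewrite !ffunE scalerDl scalerA.
pose gL : {linear _ -> _} := HB.pack g (GRing.isLinear.Build _ _ _ _ g g_lin).
rewrite /linext (lfunE gL) /= /g (bigD1 b) //= big1 ?addr0 => [|c ncb].
  by rewrite ffunE eqxx scale1r.
by rewrite ffunE (negPf ncb) scale0r.
Qed.

Section Nu.
Variables (F : fieldType) (n : nat) (l r : F).

Let m : F := r^-1 - r.

(* w true i j is \widehat{w_ij} and w false i j is w_ij, for 1 <= i < j <= n. *)
Definition w (h : bool) (i j : nat) : Dn_space F n :=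
  [ffun b => [&& lo b == i, hi b == j & flag b == h]%:R].

Definition nu1_img (h : bool) (i j : nat) : Dn_space F n :=
  let d a b := w true a b - w false a b in
  if h && (3 <= i)%N then
    (m * r ^ (j%:Z - 5)) *: d 1 i + (m * r ^ (j%:Z - 4)) *: d 2 i
    + (m * r ^ (i%:Z - 3)) *: d 1 j + (m * r ^ (i%:Z - 2)) *: d 2 j
    + (m ^+ 2 * (r ^ (i%:Z + j%:Z - 8) + r ^ (i%:Z + j%:Z - 6))) *: d 1 2
    + r *: w true i j
  else if [&& h, i == 1 & 3 <= j]%N then w false 2 j
  else if [&& h, i == 2 & 3 <= j]%N then
    w false 1 j + (m * r ^ (j%:Z - 3)) *: w false 1 2 - m *: w false 2 j
  else if [&& ~~ h, i == 2 & 3 <= j]%N then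
    w true 1 j + (m * r ^ (j%:Z - 3)) *: w true 1 2 - m *: w false 2 j
  else if [&& ~~ h, i == 1 & 3 <= j]%N then
    w true 2 j + (m * r ^ (j%:Z - 4)) *: d 1 2 + m *: d 1 j
  else if [&& h, i == 1 & j == 2]%N then l^-1 *: w true 1 2
  else r *: w h i j.

Definition nuk_img (k : nat) (h : bool) (s t : nat) : Dn_space F n :=
  if (s == k.-1) && (k.+1 <= t)%N then w h k t
  else if (t == k.-1) && (s <= k - 2)%N then w h s k
  else if (s == k.-1) && (t == k) then
    (if h then r else l^-1) *: w h k.-1 k
  else if (s == k) && (k.+1 <= t)%N then
    if h then
      w true k.-1 t + (m / l * r ^ (t%:Z - k%:Z - 2)) *: w false k.-1 k
      - m *: w true k t
    else
      w false k.-1 t + (m * r ^ (t%:Z - k%:Z - 1)) *: w false k.-1 k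
      - m *: w false k t
  else if (t == k) && (s <= k - 2)%N then
    w h s k.-1 + (m / (l * r ^ (k%:Z - s%:Z - 2))) *: w false k.-1 k
    - m *: w h s k
  else r *: w h s t.

Definition nu (k : nat) : endo (Dn_space F n) :=
  linext (fun b => if k == 1%N then nu1_img (flag b) (lo b) (hi b)
                   else nuk_img k (flag b) (lo b) (hi b)).

End Nu.

(* The root system is the set of vectors +-eps_i +-eps_j (i <> j) of Z^n, with
   base alpha_1 = eps_1 + eps_2 and alpha_k = eps_k - eps_(k-1) for k >= 2; the
   positive roots are then eps_j + eps_i and eps_j - eps_i for i < j. *)
Section CohenWales.
Variables (F : fieldType) (n : nat).

Definition eps (a : nat) : 'rV[int]_n := \row_j (j.+1 == a)%:R.
Definition alpha (k : nat) : 'rV[int]_n :=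
  if k == 1%N then eps 1 + eps 2 else eps k - eps k.-1.
Definition root_vec (b : Dn_idx n) : 'rV[int]_n :=
  if flag b then eps (hi b) + eps (lo b) else eps (hi b) - eps (lo b).
Definition dot (u v : 'rV[int]_n) : int := \sum_j u 0 j * v 0 j.

(* The basis vector x_beta if beta is a positive root, and 0 otherwise. *)
Definition xvec (beta : 'rV[int]_n) : Dn_space F n :=
  [ffun b => (root_vec b == beta)%:R].

(* For a positive root beta, the last branch is the case (alpha_k, beta) = -1. *)
Definition cw_tau (rho : F) (k : nat) : endo (Dn_space F n) :=
  linext (fun b =>
    let beta := root_vec b in
    let p := dot (alpha k) beta in
    if beta == alpha k then 0
    else if p == 1 then rho *: xvec (beta - alpha k)
    else if p == 0 then xvec beta
    else (1 - rho ^+ 2) *: xvec beta + rho *: xvec (beta + alpha k)).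

Definition cw_sigma_of (rho t : F) (T : 'I_n -> Dn_idx n -> F) (k : 'I_n) :
    endo (Dn_space F n) :=
  cw_tau rho k.+1 + t *: linext (fun b => T k b *: xvec (alpha k.+1)).

Definition int_laurent (rho x : F) : Prop :=
  exists (p : {poly int}) (d : nat), x = (map_poly intr p).[rho] / rho ^+ d.

Definition cw_family (rho t : F) (T : 'I_n -> Dn_idx n -> F) : Prop :=
  [/\ forall k b, int_laurent rho (T k b),
      forall (k : 'I_n) b, root_vec b = alpha k.+1 -> T k b = rho ^+ 4 &
      artin_rel *%R (cw_sigma_of rho t T)].

(* Definite description: for rho and t algebraically independent over the
   rationals, exactly one family satisfies cw_family. *)
Definition cw_T (rho t : F) : 'I_n -> Dn_idx n -> F :=
  xget (fun _ _ => 0) [set T | cw_family rho t T].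

Definition cw_sigma (rho t : F) : 'I_n -> endo (Dn_space F n) :=
  cw_sigma_of rho t (cw_T rho t).

Definition cohen_wales_rep (t r : F) (S : artin n -> endo (Dn_space F n)) : Prop :=
  group_rep S /\ forall k, S (artin_gen k) = cw_sigma r^-1 t k.

End CohenWales.

(* The field Q(l, r), as the fraction field of Q[r][l]. *)
Definition Qlr : fieldType := {fraction {poly {poly rat}}}.
Definition ell : Qlr := tofrac 'X.
Definition rr : Qlr := tofrac ('X)%:P.
Definition mm : Qlr := rr^-1 - rr.

(* Main.v *)
From HB Require Import structures.
Require Import Defs.
From mathcomp Require Import all_boot all_order all_algebra.
From mathcomp Require Import zify ring.
Set Implicit Arguments.
Unset Strict Implicit.
Unset Printing Implicit Defensive.
Import GRing.Theory.
Local Open Scope ring_scope.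

(** The matrices of the theorem are compared with the Cohen-Wales matrices
    through an explicit intertwiner, so that all the relations are only checked
    on the Cohen-Wales side, where the generators are rank one perturbations
    [sigma_k = tau_k + t T_k x_(alpha_k)] of very simple maps [tau_k].

    On the Cohen-Wales side, the [tau_k] satisfy the commutation and braid
    relations: two simple roots cut the positive roots into short strings, on
    which both relations are immediate ([tau_comm], [tau_braid]). Given this,
    the [sigma_k] satisfy the Artin relations as soon as the functionals [T_k]
    satisfy a linear system ([T_rules]): T_k is rho^4 at alpha_k and 0 at the
    other simple roots, T_i o tau_j = T_i when i and j are not adjacent, and
    T_j o tau_i = T_i o tau_j when they are ([sigma_comm], [sigma_braid]). An
    explicit table [cwT] solves this system ([cwf_rules]). Conversely, the Artin
    relations imply the system when T has Laurent polynomial coefficients in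
    rho and t is independent of rho ([necessity]), and an induction on the height
    of roots shows that the system has at most one solution ([T_rules_unique]).
    Hence the family selected by definite description is the table
    ([cw_sigmaE]).

    Put S_k = r sigma_k, with rho = 1/r and t = r^3/l. In the representation of
    the theorem, w_(s,t) and \hat w_(s,t) are obtained from w_12 and \hat w_12,
    eigenvectors for nodes 2 and 1, by applying generators. Applying the same
    words in the S_k to x_(alpha_2) and x_(alpha_1) gives vectors [z h s t], and
    the map [zmap] that sends w to z intertwines nu_k and S_k. Indeed every
    formula in the definition of nu_k follows from the braid relations, from
    the action of the S_i on the vectors x_(alpha_j), and from the fact that
    S_k^2 + m S_k - 1 has its image in the line of x_(alpha_k)
    ([words_rules], [intertwine_1], [intertwine_k]). The image of [zmap] is
    stable under the S_k and contains every x_(alpha_k), from which all the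
    x_beta are produced by increasing height, so that [zmap] is bijective
    ([phi_surj], [phi_invK]).

    The relations of the CGW algebra then hold for nu because they hold for S
    ([nu_cgw]): with E_k = S_k^2 + m S_k - 1, the relation g_k e_k = l^-1 e_k says
    that x_(alpha_k) has eigenvalue 1/l, and e_i g_j e_i = l e_i says that
    E_i S_j x_(alpha_i) = m x_(alpha_i). The Artin group representation
    generated by the sigma_k, conjugated by [zmap], is the one generated by
    the nu_k / r. *)

(** Proves equalities in the space of functions on a basis by evaluating both
    sides at a basis index. *)
Ltac lmod := apply/ffunP => ?; rewrite !ffunE /GRing.scale /=; ring.
Ltac lmodf := apply/ffunP => ?; rewrite !ffunE /GRing.scale /=; field.

(** * Labels of the positive roots *)

Section Roots.
Variable n : nat.

(** The pairs of labels s < t that index basis vectors; together with a flag h they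
    form the label (h, s, t) of a basis vector. *)
Definition valid (s t : nat) : bool := [&& 0 < s, s < t & t <= n]%N.

Lemma idx_valid (b : Dn_idx n) : valid (lo b) (hi b).
Proof. by case: b => -[[i j] /= ij] h; rewrite /valid /lo /hi /= ltnS ij ltn_ord. Qed.

Lemma idx_of s t h : valid s t ->
  {b : Dn_idx n | [/\ lo b = s, hi b = t & flag b = h]}.
Proof.
case: s => // s; case: t => [|t] /and3P[_ st tn]; first by [].
have sn : (s < n)%N by lia.
by exists (exist (fun p : 'I_n * 'I_n => (p.1 < p.2)%N)
   (Ordinal sn, Ordinal tn) st, h).
Qed.

Lemma idx_eq (b c : Dn_idx n) :
  (c == b) = [&& lo c == lo b, hi c == hi b & flag c == flag b].
Proof.
case: b c => -[[i j] /= ij] h [[[i' j'] /= ij'] h'].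
by rewrite /lo /hi /flag /= !xpair_eqE -val_eqE /= xpair_eqE !eqSS -!andbA.
Qed.

(** The positive root with label (h, s, t). *)
Definition rv (h : bool) (s t : nat) : 'rV[int]_n :=
  if h then eps n t + eps n s else eps n t - eps n s.

Lemma rv_at h s t (c : nat) (cn : (c < n)%N) :
  rv h s t 0 (Ordinal cn) = (c.+1 == t)%:R + (if h then 1 else -1) * (c.+1 == s)%:R.
Proof. by rewrite /rv; case: h; rewrite !mxE /= ?mul1r ?mulN1r. Qed.

Lemma rv_inj h s t h' s' t' : valid s t -> valid s' t' ->
  (rv h s t == rv h' s' t') = [&& s == s', t == t' & h == h'].
Proof.
move=> v v'; apply/eqP/and3P => [e|[/eqP-> /eqP-> /eqP->] //].
have [s0 st tn] := and3P v; have [s0' s't' t'n] := and3P v'.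
have At c (cn : (0 < c <= n)%N) : (c == t)%:R + (if h then 1 else -1) * (c == s)%:R
   = (c == t')%:R + (if h' then 1 else -1) * (c == s')%:R :> int.
  case: c cn => [|c] //= cn.
  by rewrite -!rv_at e.
have tt' : t = t'.
  case: (ltngtP t t') => // ltt.
    have := At t' ltac:(lia); rewrite eqxx !gtn_eqF ?(ltn_trans st) //.
    by case: (h) (h') => -[].
  have := At t ltac:(lia); rewrite eqxx !gtn_eqF ?(ltn_trans s't') //.
  by case: (h) (h') => -[].
have := At s ltac:(lia); rewrite -tt' eqxx (ltn_eqF st).
by case: eqP => _; case: (h) (h') => -[].
Qed.

Lemma root_vecE (b : Dn_idx n) : root_vec b = rv (flag b) (lo b) (hi b).
Proof. by []. Qed.

Lemma xvec_rv (F : fieldType) h s t : valid s t -> xvec F (rv h s t) = w F n h s t.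
Proof.
move=> v; apply/ffunP => b; rewrite !ffunE root_vecE rv_inj //.
exact: idx_valid.
Qed.

Lemma w_idx (F : fieldType) (b : Dn_idx n) :
  w F n (flag b) (lo b) (hi b) = [ffun c => (c == b)%:R].
Proof. by apply/ffunP => c; rewrite !ffunE idx_eq. Qed.

Lemma linext_w (F : fieldType) (f : bool -> nat -> nat -> Dn_space F n) h s t :
  valid s t ->
  (linext (fun b => f (flag b) (lo b) (hi b)) : 'End(Dn_space F n)) (w F n h s t)
  = f h s t.
Proof.
by case/(idx_of h) => b [<- <- <-]; rewrite w_idx linextE.
Qed.

Lemma dotDr (u v v' : 'rV[int]_n) : dot u (v + v') = dot u v + dot u v' :> int.
Proof. by rewrite -big_split; apply: eq_bigr => j _; rewrite mxE mulrDr. Qed.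
Lemma dotNr (u v : 'rV[int]_n) : dot u (- v) = - dot u v :> int.
Proof. by rewrite -sumrN; apply: eq_bigr => j _; rewrite mxE mulrN. Qed.
Lemma dotC (u v : 'rV[int]_n) : dot u v = dot v u :> int.
Proof. by apply: eq_bigr => j _; rewrite mulrC. Qed.
Lemma dotDl (u v v' : 'rV[int]_n) : dot (u + v) v' = dot u v' + dot v v' :> int.
Proof. by rewrite dotC dotDr dotC [dot v' v]dotC. Qed.
Lemma dotNl (u v : 'rV[int]_n) : dot (- u) v = - dot u v :> int.
Proof. by rewrite dotC dotNr dotC. Qed.
Lemma dot_eps a b : (0 < a <= n)%N -> dot (eps n a) (eps n b) = (a == b)%:R.
Proof.
case: a => // a /= an; rewrite /dot (bigD1 (Ordinal an)) //= big1 => [|j ja].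
  by rewrite !mxE /= eqxx mul1r addr0.
rewrite !mxE /= eqSS; suff /negPf-> : (j : nat) != a by rewrite mul0r.
by apply: contra ja => /eqP ja; apply/eqP/val_inj.
Qed.

Lemma dot_alpha k h s t : (0 < k <= n)%N -> (1 < n)%N -> valid s t ->
  dot (alpha n k) (rv h s t) =
  if k == 1%N then (t == 1%N)%:R + (t == 2%N)%:R
    + (if h then 1 else -1) * ((s == 1%N)%:R + (s == 2%N)%:R)
  else (t == k)%:R - (t == k.-1)%:R
    + (if h then 1 else -1) * ((s == k)%:R - (s == k.-1)%:R).
Proof.
move=> kn n2 v; rewrite /alpha /rv.
case: (k =P 1%N) => k1; case: h; rewrite !(dotDr, dotDl, dotNr, dotNl) !dot_eps;
 rewrite ?(eq_sym _ s) ?(eq_sym _ t); try lia; ring.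
Qed.

End Roots.

(** * The maps tau in terms of labels *)

Section Tau.
Variables (F : fieldType) (n : nat).
Hypothesis n2 : (1 < n)%N.
Variable rho : F.

Notation x := (w F n).
Notation tau k := (cw_tau n rho k : 'End(Dn_space F n)).

(** The labels of the nodes of the diagram. *)
Definition node (k : nat) : bool := (0 < k <= n)%N.

(** [step k h s t h' s' t'] states that both labels are those of positive roots
    beta and beta', and that beta' = beta - alpha_k with beta different from alpha_k. *)
Inductive step : nat -> bool -> nat -> nat -> bool -> nat -> nat -> Prop :=
| step_hi k h s of (0 < s < k)%N & (k < n)%N : step k.+1 h s k.+1 h s k
| step_loF k t of (0 < k)%N & (k.+1 < t <= n)%N :
    step k.+1 false k t false k.+1 t
| step_loT k t of (0 < k)%N & (k.+1 < t <= n)%N :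
    step k.+1 true k.+1 t true k t
| step_1 t of (2 < t <= n)%N : step 1 true 1 t false 2 t
| step_2 t of (2 < t <= n)%N : step 1 true 2 t false 1 t.

Lemma step_valid k h s t h' s' t' : step k h s t h' s' t' ->
  [/\ node k, valid n s t & valid n s' t'].
Proof. by case=> *; rewrite /valid /node; split; lia. Qed.

Lemma step_root k h s t h' s' t' : step k h s t h' s' t' ->
  rv n h' s' t' = rv n h s t - alpha n k.
Proof.
have eE (u v u' : 'rV[int]_n) : u = v - u' <-> v = u + u'.
  by split=> ->; rewrite ?subrK ?addrK.
have n0 i : (0 < i)%N -> (i == 0%N) = false by case: i.
have fin (u v : 'rV[int]_n) : (forall c, u 0 c = v 0 c) -> u = v by move/rowP.
case=> [k0 [] s0 s0k|k0 t0 k00|k0 t0 k00|t0|t0] *; apply/eE;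
  rewrite /rv /alpha ?eqSS /=; try (rewrite n0; last lia);
  apply: fin => c; rewrite !mxE; ring.
Qed.

(** The label (h, s, t) is that of the simple root alpha_k. *)
Definition simple k h s t : bool :=
  if k == 1%N then [&& h, s == 1 & t == 2]%N
  else [&& ~~ h, s.+1 == k & t == k]%N.

Lemma alpha_rv k : node k ->
  alpha n k = if k == 1%N then rv n true 1 2 else rv n false k.-1 k.
Proof. by rewrite /alpha /rv addrC; case: (k =P 1%N). Qed.

Lemma simpleP k h s t : node k -> valid n s t ->
  (rv n h s t == alpha n k) = simple k h s t.
Proof.
move=> nk v; rewrite alpha_rv // /simple; case: (k =P 1%N) => k1.
  rewrite rv_inj ?/valid ?n2 //.
  by case: h; rewrite ?andbF ?andbT.
rewrite rv_inj //; last by move: nk; rewrite /node /valid; lia.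
have -> : (s.+1 == k) = (s == k.-1) by move: nk; rewrite /node; lia.
by case: h; rewrite /= ?andbF ?andbT.
Qed.

(** The root with label (h, s, t) is orthogonal to alpha_k. *)
Definition fixed k h s t : bool :=
  if k == 1%N then (2 < s)%N || [&& ~~ h, s == 1%N & t == 2%N]
  else [&& s.+1 != k, s != k, t.+1 != k & t != k] || [&& h, s.+1 == k & t == k].

Lemma fixed_dot k h s t : node k -> valid n s t ->
  (dot (alpha n k) (rv n h s t) == 0) = fixed k h s t.
Proof.
move=> nk v; rewrite dot_alpha // /fixed.
move: nk v; rewrite /node /valid; case: k => [|k] //= kn v; rewrite eqSS.
case: (k =P 0%N) => k0.
  have -> : (t == 1%N) = false by lia.
  case: (ltnP 2 s) => s2.
    have [-> [-> ->]] : (t == 2%N) = false /\ (s == 1%N) = false /\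
      (s == 2%N) = false by lia.
    by case: h.
  have [se|se] : s = 1%N \/ s = 2%N by lia.
    by rewrite se; case: h; case: (t == 2%N).
  by have -> : (t == 2%N) = false by [lia]; rewrite se; case: h.
rewrite !eqSS.
case: (s =P k) => [sk|sk].
  have [-> ->] : (t == k) = false /\ (s == k.+1) = false by lia.
  by case: (t == k.+1); case: h.
case: (s =P k.+1) => [sk'|sk'].
  have [-> ->] : (t == k) = false /\ (t == k.+1) = false by lia.
  by case: h.
case: (t =P k.+1) => [tk'|tk']; last by case: (t =P k); case: h.
by have -> : (t == k) = false by [lia]; case: h.
Qed.

(** The position of a positive root with respect to alpha_k: it is alpha_k, or its
    inner product with alpha_k is 1, -1 or 0. *)
Inductive node_spec k h s t : Prop :=
| IsSimple of simple k h s t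
| IsDown h' s' t' of step k h s t h' s' t'
| IsUp h' s' t' of step k h' s' t' h s t
| IsFixed of fixed k h s t.

Lemma nodeP k h s t : node k -> valid n s t -> node_spec k h s t.
Proof.
move=> nk v; case S: (simple k h s t); first exact: IsSimple.
case X: (fixed k h s t); first exact: IsFixed.
move: S X; rewrite /simple /fixed; move: nk v; rewrite /node /valid.
case: k => [|k] //= kn v; rewrite !eqSS; case: (k =P 0%N) => k0.
  subst k; case: (ltnP 2 t) => t2; last by case: h; lia.
  have [->|[->|->]] // : s = 1%N \/ s = 2%N \/ (2 < s)%N by lia.
    by case: h => _ _; [apply: IsDown (step_1 _) | apply: IsUp (step_2 _)]; lia.
  by case: h => _ _; [apply: IsDown (step_2 _) | apply: IsUp (step_1 _)]; lia.
case: (s =P k) => [sk|sk]; first subst s.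
  case: (t =P k.+1) => [tk|tk]; first subst t; first by case: h; rewrite ?eqxx ?orbT.
  by case: h => _ _; [apply: IsUp (step_loT _ _) | apply: IsDown (step_loF _ _)]; lia.
case: (s =P k.+1) => [sk'|sk']; first subst s.
  by case: h => _ _; [apply: IsDown (step_loT _ _) | apply: IsUp (step_loF _ _)]; lia.
case: (t =P k.+1) => [tk'|tk']; first subst t.
  by move=> _ _; apply: IsDown (step_hi _ _ _); lia.
case: (t =P k) => [tk|tk]; last by []. subst t.
by move=> _ _; apply: IsUp (step_hi _ _ _); lia.
Qed.

Lemma dot_bounds k h s t : node k -> valid n s t ->
  let p := dot (alpha n k) (rv n h s t) in (-1 <= p <= 2).
Proof.
move=> nk v /=; rewrite dot_alpha //; move: v; rewrite /valid => v.
case: ifP => _.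
  have : ~~ ((t == 1%N) && (t == 2%N)) by lia.
  have : ~~ [&& t == 1%N & (s == 1%N) || (s == 2%N)] by lia.
  have : ~~ ((s == 1%N) && (s == 2%N)) by lia.
  by case: (t == 1%N); case: (t == 2%N); case: (s == 1%N); case: (s == 2%N); case: h.
have : ~~ ((t == k) && (t == k.-1)) by move: nk; rewrite /node; lia.
have : ~~ ((s == k) && (s == k.-1)) by move: nk; rewrite /node; lia.
have : ~~ ((s == k) && (t == k)) by lia.
have : ~~ ((s == k) && (t == k.-1)) by lia.
have : ~~ ((s == k.-1) && (t == k.-1)) by lia.
by case: (t == k); case: (t == k.-1); case: (s == k); case: (s == k.-1); case: h.
Qed.

Lemma dot_alpha2 k : node k -> dot (alpha n k) (alpha n k) = 2.
Proof.
move=> nk; rewrite {2}alpha_rv //; move: nk; rewrite /node => nk.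
case: (k =P 1%N) => k1; rewrite dot_alpha //= ?k1 //.
  have -> : (k == 1%N) = false by lia.
  rewrite !eqxx !mulrDr !mulrN !mulN1r (_ : (k == k.-1) = false); last lia.
  by rewrite (_ : (k.-1 == k) = false); last lia.
by rewrite /valid; lia.
Qed.

Lemma step_dot k h s t h' s' t' : step k h s t h' s' t' ->
  dot (alpha n k) (rv n h s t) = 1 /\ dot (alpha n k) (rv n h' s' t') = -1.
Proof.
move=> st; have [nk v v'] := step_valid st.
suff p1 : dot (alpha n k) (rv n h s t) = 1.
  by rewrite (step_root st) dotDr dotNr dot_alpha2 // p1.
rewrite dot_alpha //; case: st {nk v v'} => [k0 h0 s0|k0 t0|k0 t0|t0|t0] *.
- rewrite !eqSS !eqxx.
  have [-> [-> [-> ->]]] : (k0 == 0%N) = false /\ (k0.+1 == k0) = false /\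
    (s0 == k0.+1) = false /\ (s0 == k0) = false by lia.
  by case: h0.
- rewrite !eqSS !eqxx.
  by have [-> [-> [-> ->]]] : (k0 == 0%N) = false /\ (t0 == k0.+1) = false /\
    (t0 == k0) = false /\ (k0 == k0.+1) = false by lia.
- rewrite !eqSS !eqxx.
  by have [-> [-> [-> ->]]] : (k0 == 0%N) = false /\ (t0 == k0.+1) = false /\
    (t0 == k0) = false /\ (k0.+1 == k0) = false by lia.
- by have [-> ->] : (t0 == 1%N) = false /\ (t0 == 2%N) = false by lia.
- by have [-> ->] : (t0 == 1%N) = false /\ (t0 == 2%N) = false by lia.
Qed.

(** The value of tau_k at a basis vector, as it reads in its definition. *)
Lemma tau_w k h s t : valid n s t ->
  tau k (x h s t) =
    let p := dot (alpha n k) (rv n h s t) in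
    if rv n h s t == alpha n k then 0
    else if p == 1 then rho *: xvec F (rv n h s t - alpha n k)
    else if p == 0 then xvec F (rv n h s t)
    else (1 - rho ^+ 2) *: xvec F (rv n h s t) + rho *: xvec F (rv n h s t + alpha n k).
Proof.
exact: (@linext_w n F (fun h s t => let beta := rv n h s t in
  let p := dot (alpha n k) beta in
    if beta == alpha n k then 0
    else if p == 1 then rho *: xvec F (beta - alpha n k)
    else if p == 0 then xvec F beta
    else (1 - rho ^+ 2) *: xvec F beta + rho *: xvec F (beta + alpha n k))).
Qed.

Lemma tau_simple k h s t : node k -> valid n s t -> simple k h s t ->
  tau k (x h s t) = 0.
Proof. by move=> nk v e; rewrite tau_w //= simpleP // e. Qed.

Lemma tau_down k h s t h' s' t' : step k h s t h' s' t' ->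
  tau k (x h s t) = rho *: x h' s' t'.
Proof.
move=> st; have [nk v v'] := step_valid st; have [p _] := step_dot st.
rewrite tau_w //= p -(step_root st) xvec_rv // ifN //.
by apply/eqP => e; move: p; rewrite e dot_alpha2.
Qed.

Lemma tau_up k h s t h' s' t' : step k h s t h' s' t' ->
  tau k (x h' s' t') = (1 - rho ^+ 2) *: x h' s' t' + rho *: x h s t.
Proof.
move=> st; have [nk v v'] := step_valid st; have [_ p] := step_dot st.
rewrite tau_w //= p (step_root st) subrK -(step_root st) !xvec_rv // ifN //.
by apply/eqP => e; move: p; rewrite e dot_alpha2.
Qed.

Lemma tau_fixed k h s t : node k -> valid n s t -> fixed k h s t ->
  tau k (x h s t) = x h s t.
Proof.
move=> nk v; rewrite -fixed_dot // => /eqP p; rewrite tau_w //= p xvec_rv // ifN //.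
by apply/eqP => e; move: p; rewrite e dot_alpha2.
Qed.

End Tau.

Lemma node_ord n (i : 'I_n) : node n i.+1.
Proof. by rewrite /node /= ltn_ord. Qed.

(** * The explicit coefficients of the Cohen-Wales family *)

Section TTable.
Variables (F : fieldType) (n : nat).
Hypothesis n2 : (1 < n)%N.
Variable rho : F.
Hypothesis rho0 : rho != 0.

Let mu := rho ^+ 2 - 1.

(** Powers of rho as a separate symbol, so that powers with variable and with
    constant exponents are not mixed up by simplification. *)
Definition pw (k : nat) : F := rho ^+ k.
Lemma pwS k : pw k.+1 = rho * pw k. Proof. exact: exprS. Qed.
Lemma pw0 k : pw k != 0. Proof. exact: expf_neq0. Qed.
Lemma pw_0 : pw 0 = 1. Proof. by []. Qed.

(** The coefficient T_(k, beta) for the root beta with label (h, s, t). All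
    exponents of rho are nonnegative on the positive roots where they occur. *)
Definition cwT (k : nat) (h : bool) (s t : nat) : F :=
  let P := pw in
  let far := P s * P t / rho ^+ 5 * (mu ^+ 2 * (rho ^+ 2 + 1)) in
  if k == 1%N then
    if h then
      if s == 1%N then if t == 2%N then rho ^+ 4 else P t * mu
      else if s == 2%N then rho * P t * mu
      else far
    else 0
  else if (k < s)%N then if h then far else 0
  else if s == k then if h then P k * P t / rho * mu else 0
  else if s.+1 == k then
    if t == k then if h then (P k ^+ 2 / rho ^+ 2 - rho ^+ 2) * mu else rho ^+ 4
    else if h then P t / P k * (P k ^+ 2 / rho ^+ 4 - 1) * mu ^+ 2
    else P t / P k * rho ^+ 2 * mu
  else if t == k then (if h then P s * P k / rho else P k / P s * rho) * mu
  else if (k < t)%N then (if h then P s * P t / rho ^+ 3 else P t / P s / rho) * mu ^+ 2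
  else 0.

(** Splits on all the tests in the goal, and discards the inconsistent cases. *)
Ltac ifs := repeat (case: ifP => ?; try (exfalso; lia)).

(** For nodes i and j that are not adjacent, T_i o tau_j = T_i on the string of beta
    under alpha_j. *)
Lemma cwT_commute i j h s t h' s' t' : node n i -> i != j -> ~~ Dn_adj i j ->
  step n j h s t h' s' t' -> cwT i h s t = rho * cwT i h' s' t'.
Proof.
rewrite /node /Dn_adj => ni ij nadj st; move: ni ij nadj.
case: st => [k0 h0 s0|k0 t0|k0 t0|t0|t0] *; rewrite /cwT.
all: ifs.
all: try by rewrite ?mulr0.
all: try (have i2 : i = 2%N by [lia]; subst i).
all: rewrite ?pwS ?pw_0 /mu; field.
all: rewrite ?pw0 ?rho0 //.
Qed.

(** For adjacent i and j, the identity T_j o tau_i = T_i o tau_j on a chain of three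
    roots y0, y1 = y0 + alpha_i, y2 = y1 + alpha_j, spelled out at y0, y1 and y2. *)
Lemma cwT_chain i j h0 s0 t0 h1 s1 t1 h2 s2 t2 : Dn_adj i j ->
  step n i h1 s1 t1 h0 s0 t0 -> step n j h2 s2 t2 h1 s1 t1 ->
  [/\ (1 - rho ^+ 2) * cwT j h0 s0 t0 + rho * cwT j h1 s1 t1 = cwT i h0 s0 t0,
      rho * cwT j h0 s0 t0 = (1 - rho ^+ 2) * cwT i h1 s1 t1 + rho * cwT i h2 s2 t2 &
      cwT j h2 s2 t2 = rho * cwT i h1 s1 t1].
Proof.
rewrite /Dn_adj => adj st1 st2; move: adj.
case: st1 st2 => [k0 h s c1 c2|k0 t c1 c2|k0 t c1 c2|t c1|t c1] st2 adj; inversion st2; subst.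
all: try (exfalso; lia).
all: try (have e : k0 = s.+1 by [lia]; subst k0).
all: try (have e : k0 = 2%N by [lia]; subst k0).
all: rewrite /cwT /=; split.
all: ifs.
all: rewrite ?pwS ?pw_0 /mu; try field.
all: rewrite ?pw0 ?rho0 //.
Qed.

Lemma cwT_fixed i j h s t : Dn_adj i j -> valid n s t ->
  fixed i h s t -> fixed j h s t -> cwT i h s t = cwT j h s t.
Proof.
suff E a b : ((a == 1) && (b == 3) || (2 <= a) && (b == a.+1))%N -> valid n s t ->
    fixed a h s t -> fixed b h s t -> cwT a h s t = cwT b h s t.
  by case/orP => e v fi fj; [apply: E | apply/esym/E].
rewrite /valid /fixed => e v.
have [[-> ->]|[a2 ->]] : a = 1%N /\ b = 3%N \/ (1 < a)%N /\ b = a.+1 by lia.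
  by case: h => /= f1 f2; rewrite /cwT /=; ifs.
have [-> ->] : (a == 1%N) = false /\ (a.+1 == 1%N) = false by lia.
by case: h => /= f1 f2; rewrite /cwT; ifs.
Qed.

Lemma cwT_simple_other i j h s t : node n i -> node n j -> i != j ->
  valid n s t -> simple j h s t -> cwT i h s t = 0.
Proof.
rewrite /node /valid /simple => ni nj ij v; case: (j =P 1%N) => j1.
  case: h => //= st; have [-> ->] : s = 1%N /\ t = 2%N by lia.
  rewrite /cwT /=; ifs => //.
  by have -> : i = 2%N by [lia]; rewrite /pw; field.
by case: h => //= st; rewrite /cwT; ifs.
Qed.

Lemma cwT_simple i h s t : node n i ->
  valid n s t -> simple i h s t -> cwT i h s t = rho ^+ 4.
Proof.
rewrite /node /valid /simple => ni v; case: (i =P 1%N) => i1.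
  by case: h => //= st; have [-> ->] : s = 1%N /\ t = 2%N by [lia]; rewrite i1.
by case: h => //= st; rewrite /cwT; ifs.
Qed.

(** The value at alpha_i + alpha_j, for adjacent i and j. *)
Lemma cwT_sum i j h s t h' s' t' : Dn_adj i j ->
  step n i h s t h' s' t' -> simple j h' s' t' -> cwT i h s t = mu * rho ^+ 3.
Proof.
rewrite /Dn_adj /simple => adj st; move: adj.
case: st => [k0 h0 s0 c1 c2|k0 t0 c1 c2|k0 t0 c1 c2|t0 c1|t0 c1] adj; case: (j =P 1%N) => j1.
all: try case: h0; rewrite /= => e; try (exfalso; lia).
all: try (have e' : k0 = s0.+1 by [lia]; subst k0).
all: try (have e' : t0 = 3%N by [lia]; subst t0).
all: try (have e' : s0 = 1%N by [lia]; subst s0).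
all: try (have e' : t0 = k0.+2 by [lia]; subst t0).
all: rewrite /cwT /=; ifs.
all: rewrite ?pwS ?pw_0 /mu; field.
all: rewrite ?pw0 ?rho0 //.
Qed.

End TTable.

(** * Root strings under one or two simple roots *)

Section Roots2.
Variables (n : nat).
Hypothesis n2 : (1 < n)%N.

Notation al := (alpha n).
Notation rv := (rv n).

Lemma dot_cartan i j : node n i -> node n j -> i != j ->
  dot (al i) (al j) = if Dn_adj i j then -1 else 0.
Proof.
move=> ni nj ij; rewrite (alpha_rv nj); case: (j =P 1%N) => j1.
  subst j; rewrite dot_alpha //.
  move: ni ij; rewrite /node => ni ij; rewrite (negPf ij).
  have -> : Dn_adj i 1 = (i == 3)%N by rewrite /Dn_adj; lia.
  have [-> [-> ->]] : (2 == i.-1) = (i == 3)%N /\ (1%N == i) = false /\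
    (1%N == i.-1) = (2 == i)%N by lia.
  by case: (2 =P i) => [<-|_] //; case: (i == 3)%N.
rewrite dot_alpha //; last by move: nj j1; rewrite /node /valid; lia.
move: ni nj ij; rewrite /node => ni nj ij; case: (i =P 1%N) => i1.
  subst i; have -> : (j == 1%N) = false by lia.
  have [-> ->] : (j.-1 == 1%N) = (j == 2)%N /\ (j.-1 == 2)%N = (j == 3)%N by lia.
  have -> : Dn_adj 1 j = (j == 3)%N by rewrite /Dn_adj; lia.
  by case: (j =P 2)%N => [->|_] //; case: (j == 3)%N.
have [-> ->] : (j == i) = false /\ (j.-1 == i.-1) = false by lia.
have [-> ->] : (j == i.-1) = (i == j.+1) /\ (j.-1 == i) = (j == i.+1) by lia.
have -> : Dn_adj i j = (i == j.+1) || (j == i.+1) by rewrite /Dn_adj; lia.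
by case e1 : (i == j.+1); case e2 : (j == i.+1) => //; exfalso; lia.
Qed.

Lemma dot_eq2 k h s t : node n k -> valid n s t ->
  (dot (al k) (rv h s t) == 2) = simple k h s t.
Proof.
move=> nk v; apply/eqP/idP => [p|]; last first.
  by rewrite -(simpleP n2 h nk v) => /eqP ->; rewrite dot_alpha2.
case: (nodeP n2 h nk v) => [//|h' s' t' st|h' s' t' st|].
- by have [q _] := step_dot n2 st; rewrite q in p.
- by have [_ q] := step_dot n2 st; rewrite q in p.
- by rewrite -(fixed_dot n2 h nk v) => /eqP q; rewrite q in p.
Qed.

Lemma dot_eq1 k h s t : node n k -> valid n s t -> dot (al k) (rv h s t) = 1 ->
  exists h' s' t', step n k h s t h' s' t'.
Proof.
move=> nk v p; case: (nodeP n2 h nk v) => [|h' s' t' st|h' s' t' st|].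
- by rewrite -dot_eq2 // p.
- by exists h', s', t'.
- by have [_ q] := step_dot n2 st; rewrite q in p.
- by rewrite -(fixed_dot n2 h nk v) p.
Qed.

Lemma dot_eqN1 k h s t : node n k -> valid n s t -> dot (al k) (rv h s t) = -1 ->
  exists h' s' t', step n k h' s' t' h s t.
Proof.
move=> nk v p; case: (nodeP n2 h nk v) => [|h' s' t' st|h' s' t' st|].
- by rewrite -dot_eq2 // p.
- by have [q _] := step_dot n2 st; rewrite q in p.
- by exists h', s', t'.
- by rewrite -(fixed_dot n2 h nk v) p.
Qed.

Lemma dot_step i j h s t h' s' t' : step n i h s t h' s' t' ->
  dot (al j) (rv h' s' t') = dot (al j) (rv h s t) - dot (al j) (al i).
Proof. by move=> st; rewrite (step_root n2 st) dotDr dotNr. Qed.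

(** The orbits of positive roots under two adjacent simple roots: alpha_i, alpha_j,
    their sum, a root orthogonal to both, or one of the three roots of a chain. *)
Inductive A2_spec i j h s t : Prop :=
| A2_left of simple i h s t
| A2_right of simple j h s t
| A2_sum h1 s1 t1 h2 s2 t2 of step n i h s t h1 s1 t1 & simple j h1 s1 t1 &
    step n j h s t h2 s2 t2 & simple i h2 s2 t2
| A2_fixed of fixed i h s t & fixed j h s t
| A2_chain i' j' h0 s0 t0 h1 s1 t1 h2 s2 t2 of
    (i', j') = (i, j) \/ (i', j') = (j, i) &
    step n i' h1 s1 t1 h0 s0 t0 & step n j' h2 s2 t2 h1 s1 t1 &
    [\/ (h, s, t) = (h0, s0, t0), (h, s, t) = (h1, s1, t1) | (h, s, t) = (h2, s2, t2)].

Lemma A2P i j h s t : node n i -> node n j -> i != j -> Dn_adj i j -> valid n s t ->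
  A2_spec i j h s t.
Proof.
move=> ni nj ij adj v.
have c : dot (al i) (al j) = -1 by rewrite dot_cartan // adj.
have c' : dot (al j) (al i) = -1 by rewrite dotC.
case: (nodeP n2 h ni v) => [|h1 s1 t1 st1|h1 s1 t1 st1|f1]; first exact: A2_left.
- have [_ _ v1] := step_valid n2 st1.
  case: (nodeP n2 h nj v) => [|h2 s2 t2 st2|h2 s2 t2 st2|f2]; first exact: A2_right.
  + have [_ _ v2] := step_valid n2 st2.
    have [p1 _] := step_dot n2 st1; have [p2 _] := step_dot n2 st2.
    by apply: (A2_sum st1 _ st2); rewrite -dot_eq2 // ?(dot_step _ st1) ?(dot_step _ st2)
      ?p1 ?p2 ?c ?c'.
  + apply: (A2_chain (or_introl erefl) st1 st2); exact: Or32.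
  have p : dot (al j) (rv h1 s1 t1) = 1.
    by rewrite (dot_step _ st1) c'; move: f2; rewrite -(fixed_dot n2 h nj v) => /eqP->.
  have [h0 [s0 [t0 st0]]] := dot_eq1 nj v1 p.
  apply: (A2_chain (or_intror erefl) st0 st1); exact: Or33.
- have [_ v1 _] := step_valid n2 st1.
  case: (nodeP n2 h nj v) => [|h2 s2 t2 st2|h2 s2 t2 st2|f2]; first exact: A2_right.
  + apply: (A2_chain (or_intror erefl) st2 st1); exact: Or32.
  + have [_ p2] := step_dot n2 st2.
    have := dot_bounds n2 h1 nj v1; rewrite /=.
    by move: p2; rewrite (dot_step _ st1) c' => p2; lia.
  have p : dot (al j) (rv h1 s1 t1) = -1.
    move: f2; rewrite -(fixed_dot n2 h nj v) (dot_step _ st1) c' => /eqP; lia.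
  have [h0 [s0 [t0 st0]]] := dot_eqN1 nj v1 p.
  apply: (A2_chain (or_introl erefl) st1 st0); exact: Or31.
- case: (nodeP n2 h nj v) => [|h2 s2 t2 st2|h2 s2 t2 st2|f2]; first exact: A2_right.
  + have [_ _ v2] := step_valid n2 st2.
    have p : dot (al i) (rv h2 s2 t2) = 1.
      by rewrite (dot_step _ st2) c; move: f1; rewrite -(fixed_dot n2 h ni v) => /eqP->.
    have [h0 [s0 [t0 st0]]] := dot_eq1 ni v2 p.
    apply: (A2_chain (or_introl erefl) st0 st2); exact: Or33.
  + have [_ v2 _] := step_valid n2 st2.
    have p : dot (al i) (rv h2 s2 t2) = -1.
      move: f1; rewrite -(fixed_dot n2 h ni v) (dot_step _ st2) c => /eqP; lia.
    have [h0 [s0 [t0 st0]]] := dot_eqN1 ni v2 p.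
    apply: (A2_chain (or_intror erefl) st2 st0); exact: Or31.
  exact: A2_fixed.
Qed.

(** A shifted height of roots: the height plus 2. *)
Definition ht (h : bool) (s t : nat) : nat := if h then (s + t)%N else (t - s + 2)%N.

Lemma step_ht k h s t h' s' t' : step n k h s t h' s' t' -> (ht h' s' t' < ht h s t)%N.
Proof. by rewrite /ht; case=> [k0 [] s0|k0 t0|k0 t0|t0|t0] *; lia. Qed.

(** A positive root beta other than a simple root can be lowered by some alpha_j
    with j different from k; if not, alpha_k lowers it, and beta is orthogonal to
    some alpha_j with j adjacent to k. *)
Lemma descent k h s t : node n k -> valid n s t -> ~~ simple t h s t -> ~~ simple 1 h s t ->
  (exists j h' s' t', j != k /\ step n j h s t h' s' t') \/
  (exists j h' s' t', [/\ node n j, Dn_adj k j, k != j, fixed j h s t & step n k h s t h' s' t']).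
Proof.
rewrite /node /valid /simple => nk v; have [-> ->] : (t == 1%N) = false /\ (t == t) by lia.
case: h => /=; last first.
  move=> e _; left; case: (k =P t) => kt.
    exists s.+1, false, s.+1, t; split; first lia.
    by apply: step_loF; lia.
  exists t, false, s, t.-1; split; first lia.
  have {1 2}-> : t = t.-1.+1 by lia.
  by apply: step_hi; lia.
move=> _ e; case: (ltnP s.+1 t) => st; last first.
  have {st}st : t = s.+1 by lia.
  subst t; have s2 : (2 <= s)%N by lia.
  case: s v e s2 => [|[|[|s]]] // v e _.
    left; case: (k =P 1%N) => k1.
      by exists 2%N, true, 1%N, 3; split; [lia|apply: step_loT; lia].
    by exists 1%N, false, 1%N, 3; split; [lia|apply: step_2; lia].
  case: (k =P s.+3) => k1; last first.
    by left; exists s.+3, true, s.+2, s.+4; split; [lia|apply: step_loT; lia].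
  right; exists s.+4, true, s.+2, s.+4; split; rewrite /Dn_adj /fixed /=; try lia.
  by rewrite k1; apply: step_loT; lia.
left; case: (k =P t) => kt; last first.
  exists t, true, s, t.-1; split; first lia.
  have {1 2}-> : t = t.-1.+1 by lia.
  by apply: step_hi; lia.
case: s v e st => [|[|s]] // v e st.
  by exists 1%N, false, 2%N, t; split; [lia|apply: step_1; lia].
by exists s.+2, true, s.+1, t; split; [lia|apply: step_loT; lia].
Qed.

End Roots2.

(** * Commutation and braid relations for tau *)

Section TauRel.
Variables (F : fieldType) (n : nat).
Hypothesis n2 : (1 < n)%N.
Variable rho : F.

Notation x := (w F n).
Variable tau : nat -> 'End(Dn_space F n).

(** The action of tau_k on basis vectors, in terms of labels. From here on, tau is
    any family of maps with this action. *)
Record tau_rules : Prop := TauRules {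
  ruleS : forall k h s t, node n k -> valid n s t -> simple k h s t ->
    tau k (x h s t) = 0;
  ruleD : forall k h s t h' s' t', step n k h s t h' s' t' ->
    tau k (x h s t) = rho *: x h' s' t';
  ruleU : forall k h s t h' s' t', step n k h s t h' s' t' ->
    tau k (x h' s' t') = (1 - rho ^+ 2) *: x h' s' t' + rho *: x h s t;
  ruleF : forall k h s t, node n k -> valid n s t -> fixed k h s t ->
    tau k (x h s t) = x h s t }.
Hypothesis rules : tau_rules.
Notation al := (alpha n).

Lemma w_sum (v : Dn_space F n) : v = \sum_b v b *: x (flag b) (lo b) (hi b).
Proof.
apply/ffunP => c; rewrite sum_ffunE (bigD1 c) //= w_idx !ffunE eqxx /GRing.scale /= mulr1.
rewrite big1 ?addr0 // => b bc; rewrite w_idx !ffunE eq_sym (negPf bc).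
exact: mulr0.
Qed.

(** Linear maps that agree on the basis vectors are equal. *)
Lemma w_ext (W : lmodType F) (f g : Dn_space F n -> W) : linear f -> linear g ->
  (forall h s t, valid n s t -> f (x h s t) = g (x h s t)) -> f =1 g.
Proof.
move=> lf lg fg v; rewrite [v]w_sum.
have f0 : f 0 = 0 by have := lf (-1) 0 0; rewrite scaler0 addr0 scaleN1r addNr.
have g0 : g 0 = 0 by have := lg (-1) 0 0; rewrite scaler0 addr0 scaleN1r addNr.
rewrite -big_enum /=; elim: (enum _) => [|b e IH]; first by rewrite big_nil f0.
by rewrite big_cons lf lg IH fg // idx_valid.
Qed.

(** The basis vector of the simple root alpha_k. *)
Definition xa k : Dn_space F n := xvec F (al k).

Lemma xa_simple k h s t : node n k -> valid n s t -> simple k h s t -> xa k = x h s t.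
Proof. by move=> nk v; rewrite -(simpleP n2 h nk v) /xa => /eqP <-; rewrite xvec_rv. Qed.

Lemma simple_ex k : node n k -> exists h s t, valid n s t /\ simple k h s t.
Proof.
rewrite /node => nk; case: (k =P 1%N) => k1.
  by exists true, 1%N, 2%N; rewrite /valid /simple k1.
exists false, k.-1, k; rewrite /valid /simple; have -> : (k == 1%N) = false by lia.
by rewrite eqxx; lia.
Qed.

Lemma tau_xa k : node n k -> tau k (xa k) = 0.
Proof.
move=> nk; have [h [s [t [v sm]]]] := simple_ex nk.
by rewrite (xa_simple nk v sm) (ruleS rules).
Qed.

Lemma rv_eq h s t h' s' t' : valid n s t -> valid n s' t' ->
  rv n h s t = rv n h' s' t' -> (h, s, t) = (h', s', t').
Proof. by move=> v v' /eqP; rewrite rv_inj // => /and3P[/eqP-> /eqP-> /eqP->]. Qed.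

Section Orth.
Variables i j : nat.
Hypotheses (ni : node n i) (nj : node n j) (c : dot (al i) (al j) = 0).

Lemma orth_fixed h s t : valid n s t -> simple i h s t -> fixed j h s t.
Proof.
move=> v; rewrite -(simpleP n2 h ni v) => /eqP e.
by rewrite -(fixed_dot n2 h nj v) e dotC c.
Qed.

(** For orthogonal alpha_i and alpha_j, moves by alpha_i and by alpha_j complete to a
    square; this lemma and the next two treat the possible directions of the moves. *)
Lemma square_dd h s t h1 s1 t1 h2 s2 t2 :
  step n i h s t h1 s1 t1 -> step n j h s t h2 s2 t2 ->
  exists h3 s3 t3, step n j h1 s1 t1 h3 s3 t3 /\ step n i h2 s2 t2 h3 s3 t3.
Proof.
move=> st1 st2; have [_ _ v1] := step_valid n2 st1; have [_ _ v2] := step_valid n2 st2.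
have [p1 _] := step_dot n2 st1; have [p2 _] := step_dot n2 st2.
have p3 : dot (al j) (rv n h1 s1 t1) = 1.
  by rewrite (dot_step n2 j st1) p2 dotC c.
have [h3 [s3 [t3 st3]]] := dot_eq1 n2 nj v1 p3.
have p4 : dot (al i) (rv n h2 s2 t2) = 1.
  by rewrite (dot_step n2 i st2) p1 c.
have [h4 [s4 [t4 st4]]] := dot_eq1 n2 ni v2 p4.
have [_ _ v3] := step_valid n2 st3; have [_ _ v4] := step_valid n2 st4.
have [e1 e2 e3] : (h4, s4, t4) = (h3, s3, t3).
  apply: rv_eq => //; rewrite (step_root n2 st3) (step_root n2 st4).
  by rewrite (step_root n2 st1) (step_root n2 st2) addrAC.
by exists h3, s3, t3; split; rewrite -?e1 -?e2 -?e3 // e1 e2 e3.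
Qed.

Lemma square_du h s t h1 s1 t1 h2 s2 t2 :
  step n i h s t h1 s1 t1 -> step n j h2 s2 t2 h s t ->
  exists h3 s3 t3, step n j h3 s3 t3 h1 s1 t1 /\ step n i h2 s2 t2 h3 s3 t3.
Proof.
move=> st1 st2; have [_ _ v1] := step_valid n2 st1; have [_ v2 _] := step_valid n2 st2.
have [p1 _] := step_dot n2 st1; have [_ p2] := step_dot n2 st2.
have p3 : dot (al j) (rv n h1 s1 t1) = -1.
  by rewrite (dot_step n2 j st1) p2 dotC c.
have [h3 [s3 [t3 st3]]] := dot_eqN1 n2 nj v1 p3.
have p4 : dot (al i) (rv n h2 s2 t2) = 1.
  by have := dot_step n2 i st2; rewrite p1 c subr0.
have [h4 [s4 [t4 st4]]] := dot_eq1 n2 ni v2 p4.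
have [_ v3 _] := step_valid n2 st3; have [_ _ v4] := step_valid n2 st4.
have [e1 e2 e3] : (h4, s4, t4) = (h3, s3, t3).
  apply: rv_eq => //; rewrite (step_root n2 st4).
  apply: (addIr (- al j)); rewrite addrAC -(step_root n2 st2) -(step_root n2 st3).
  by rewrite (step_root n2 st1).
by exists h3, s3, t3; split; rewrite -?e1 -?e2 -?e3 // e1 e2 e3.
Qed.

Lemma square_uu h s t h1 s1 t1 h2 s2 t2 :
  step n i h1 s1 t1 h s t -> step n j h2 s2 t2 h s t ->
  exists h3 s3 t3, step n j h3 s3 t3 h1 s1 t1 /\ step n i h3 s3 t3 h2 s2 t2.
Proof.
move=> st1 st2; have [_ v1 _] := step_valid n2 st1; have [_ v2 _] := step_valid n2 st2.
have [_ p1] := step_dot n2 st1; have [_ p2] := step_dot n2 st2.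
have p3 : dot (al j) (rv n h1 s1 t1) = -1.
  by have := dot_step n2 j st1; rewrite p2 (dotC (al j) (al i)) c subr0.
have [h3 [s3 [t3 st3]]] := dot_eqN1 n2 nj v1 p3.
have p4 : dot (al i) (rv n h2 s2 t2) = -1.
  by have := dot_step n2 i st2; rewrite p1 c subr0.
have [h4 [s4 [t4 st4]]] := dot_eqN1 n2 ni v2 p4.
have [_ v3 _] := step_valid n2 st3; have [_ v4 _] := step_valid n2 st4.
have [e1 e2 e3] : (h4, s4, t4) = (h3, s3, t3).
  apply: rv_eq => //; apply: (addIr (- al i)); apply: (addIr (- al j)).
  rewrite -(step_root n2 st4) -(step_root n2 st2) addrAC.
  by rewrite -(step_root n2 st3) -(step_root n2 st1).
by exists h3, s3, t3; split; rewrite -?e1 -?e2 -?e3 // e1 e2 e3.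
Qed.

Lemma orth_fixed_down h s t h1 s1 t1 : step n i h s t h1 s1 t1 ->
  fixed j h s t = fixed j h1 s1 t1.
Proof.
move=> st; have [_ v v1] := step_valid n2 st.
by rewrite -(fixed_dot n2 h nj v) -(fixed_dot n2 h1 nj v1) (dot_step n2 j st) (dotC (al j) (al i)) c subr0.
Qed.

End Orth.

Lemma tau_comm i j : node n i -> node n j -> i != j -> ~~ Dn_adj i j ->
  forall v, tau i (tau j v) = tau j (tau i v).
Proof.
move=> ni nj ij nadj.
have c : dot (al i) (al j) = 0 by rewrite dot_cartan // (negPf nadj).
have c' : dot (al j) (al i) = 0 by rewrite dotC.
apply: w_ext; [by move=> a u v; rewrite !linearP..|] => h s t v.
case: (nodeP n2 h ni v) => [si|hi si ti sti|hi si ti sti|fi].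
- have fj := orth_fixed ni nj c v si.
  by rewrite (ruleS rules ni v si) linear0 (ruleF rules nj v fj) (ruleS rules ni v si).
- have [_ _ vi] := step_valid n2 sti.
  case: (nodeP n2 h nj v) => [sj|hj sj tj stj|hj sj tj stj|fj].
  + have fi := orth_fixed nj ni c' v sj; move: (fi).
    by rewrite -(fixed_dot n2 h ni v) => /eqP; have [-> _] := step_dot n2 sti.
  + have [h3 [s3 [t3 [st3 st4]]]] := square_dd ni nj c sti stj.
    rewrite (ruleD rules sti) (ruleD rules stj) !linearZ /=.
    by rewrite (ruleD rules st3) (ruleD rules st4).
  + have [h3 [s3 [t3 [st3 st4]]]] := square_du ni nj c sti stj.
    rewrite (ruleU rules stj) (ruleD rules sti) linearD !linearZ /=.
    rewrite (ruleD rules sti) (ruleD rules st4) (ruleU rules st3).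
    lmod.
  rewrite (ruleF rules nj v fj) (ruleD rules sti) linearZ /=.
  by rewrite (ruleF rules nj vi) // -(orth_fixed_down nj c sti).
- have [_ vi _] := step_valid n2 sti.
  case: (nodeP n2 h nj v) => [sj|hj sj tj stj|hj sj tj stj|fj].
  + have fi := orth_fixed nj ni c' v sj; move: (fi).
    by rewrite -(fixed_dot n2 h ni v) => /eqP; have [_ ->] := step_dot n2 sti.
  + have [h3 [s3 [t3 [st3 st4]]]] := square_du nj ni c' stj sti.
    rewrite (ruleU rules sti) (ruleD rules stj) linearD !linearZ /=.
    rewrite (ruleD rules stj) (ruleD rules st4) (ruleU rules st3).
    lmod.
  + have [h3 [s3 [t3 [st3 st4]]]] := square_uu ni nj c sti stj.
    rewrite (ruleU rules sti) (ruleU rules stj) !linearD !linearZ /=.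
    rewrite (ruleU rules sti) (ruleU rules stj) (ruleU rules st3) (ruleU rules st4).
    lmod.
  rewrite (ruleF rules nj v fj) (ruleU rules sti) linearD !linearZ /=.
  by rewrite !(ruleF rules nj) // (orth_fixed_down nj c sti).
rewrite (ruleF rules ni v fi).
case: (nodeP n2 h nj v) => [sj|hj sj tj stj|hj sj tj stj|fj].
- by rewrite (ruleS rules nj v sj) linear0.
- have [_ _ vj] := step_valid n2 stj.
  rewrite (ruleD rules stj) linearZ /= (ruleF rules ni vj) //.
  by rewrite -(orth_fixed_down ni c' stj).
- have [_ vj _] := step_valid n2 stj.
  rewrite (ruleU rules stj) linearD !linearZ /= (ruleF rules ni v fi).
  by rewrite (ruleF rules ni vj) // (orth_fixed_down ni c' stj).
by rewrite (ruleF rules nj v fj) (ruleF rules ni v fi).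
Qed.

Lemma chain_fixed i j h0 s0 t0 h1 s1 t1 h2 s2 t2 : i != j -> Dn_adj i j ->
  step n i h1 s1 t1 h0 s0 t0 -> step n j h2 s2 t2 h1 s1 t1 ->
  fixed j h0 s0 t0 /\ fixed i h2 s2 t2.
Proof.
move=> ij adj st1 st2; have [ni v1 v0] := step_valid n2 st1.
have [nj v2 _] := step_valid n2 st2.
have c : dot (al i) (al j) = -1 by rewrite dot_cartan // adj.
rewrite -(fixed_dot n2 h0 nj v0) -(fixed_dot n2 h2 ni v2).
have [p1 _] := step_dot n2 st1; have [_ p2] := step_dot n2 st2.
rewrite (dot_step n2 j st1) p2 (dotC (al j)) c; split=> //.
by move: (dot_step n2 i st2); rewrite p1 c => e; apply/eqP; lia.
Qed.

(** Labels of alpha_i + alpha_j and alpha_j, starting from that of alpha_i. *)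
Lemma sum_labels i j h s t : node n i -> node n j -> i != j -> Dn_adj i j ->
  valid n s t -> simple i h s t ->
  exists h1 s1 t1 h2 s2 t2, [/\ step n j h1 s1 t1 h s t,
    step n i h1 s1 t1 h2 s2 t2 & simple j h2 s2 t2].
Proof.
move=> ni nj ij adj v si.
have c : dot (al i) (al j) = -1 by rewrite dot_cartan // adj.
have e : rv n h s t = al i by apply/eqP; rewrite simpleP.
have p1 : dot (al j) (rv n h s t) = -1 by rewrite e dotC.
have [h1 [s1 [t1 st1]]] := dot_eqN1 n2 nj v p1; have [_ v1 _] := step_valid n2 st1.
have p2 : dot (al i) (rv n h1 s1 t1) = 1.
  by have := dot_step n2 i st1; rewrite c e dot_alpha2 // => q; lia.
have [h2 [s2 [t2 st2]]] := dot_eq1 n2 ni v1 p2; have [_ _ v2] := step_valid n2 st2.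
exists h1, s1, t1, h2, s2, t2; split=> //; rewrite -(dot_eq2 n2 h2 nj v2).
by have [q _] := step_dot n2 st1; rewrite (dot_step n2 j st2) q (dotC (al j)) c.
Qed.

Lemma tau_braid_chain i j h0 s0 t0 h1 s1 t1 h2 s2 t2 : i != j -> Dn_adj i j ->
  step n i h1 s1 t1 h0 s0 t0 -> step n j h2 s2 t2 h1 s1 t1 ->
  [/\ tau i (tau j (tau i (x h0 s0 t0))) = tau j (tau i (tau j (x h0 s0 t0))),
      tau i (tau j (tau i (x h1 s1 t1))) = tau j (tau i (tau j (x h1 s1 t1))) &
      tau i (tau j (tau i (x h2 s2 t2))) = tau j (tau i (tau j (x h2 s2 t2)))].
Proof.
move=> ij adj st1 st2; have [f0 f2] := chain_fixed ij adj st1 st2.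
have [ni v1 v0] := step_valid n2 st1; have [nj v2 _] := step_valid n2 st2.
have i0 := ruleU rules st1; have i1 := ruleD rules st1; have i2 := ruleF rules ni v2 f2.
have j0 := ruleF rules nj v0 f0; have j1 := ruleU rules st2; have j2 := ruleD rules st2.
have R := (i0, i1, i2, j0, j1, j2).
by split; do 4! rewrite ?R ?linearD ?linearZ /=; lmod.
Qed.

Lemma tau_braid i j : node n i -> node n j -> i != j -> Dn_adj i j ->
  forall v, tau i (tau j (tau i v)) = tau j (tau i (tau j v)).
Proof.
move=> ni nj ij adj.
have ji : j != i by rewrite eq_sym.
have adj' : Dn_adj j i by rewrite /Dn_adj orbC.
apply: w_ext; [by move=> a u v; rewrite !linearP..|] => h s t v.
case: (A2P n2 h ni nj ij adj v) => [si|sj|h1 s1 t1 h2 s2 t2 st1 sj st2 si|fi fj|].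
- have [h1 [s1 [t1 [h2 [s2 [t2 [st1 st2 sj]]]]]]] := sum_labels ni nj ij adj v si.
  have [_ _ v2] := step_valid n2 st2.
  rewrite (ruleU rules st1) !(ruleS rules ni v si) !linearD !linearZ /=.
  rewrite (ruleS rules ni v si) (ruleD rules st2) !linearZ /= (ruleS rules nj v2 sj).
  by rewrite !linear0 ?scaler0 ?addr0.
- have [h1 [s1 [t1 [h2 [s2 [t2 [st1 st2 si]]]]]]] := sum_labels nj ni ji adj' v sj.
  have [_ _ v2] := step_valid n2 st2.
  rewrite (ruleU rules st1) !(ruleS rules nj v sj) !linearD !linearZ /=.
  rewrite (ruleS rules nj v sj) (ruleD rules st2) !linearZ /= (ruleS rules ni v2 si).
  by rewrite !linear0 ?scaler0 ?addr0.
- have [_ _ v1] := step_valid n2 st1; have [_ _ v2] := step_valid n2 st2.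
  rewrite (ruleD rules st1) (ruleD rules st2) !linearZ /=.
  by rewrite (ruleS rules nj v1 sj) (ruleS rules ni v2 si) !linear0 ?scaler0.
- by rewrite !(ruleF rules ni v fi, ruleF rules nj v fj).
move=> a b h0 s0 t0 h1 s1 t1 h2 s2 t2 [] [-> ->] st1 st2.
  by have [? ? ?] := tau_braid_chain ij adj st1 st2; case=> [] [-> -> ->].
by have [? ? ?] := tau_braid_chain ji adj' st1 st2; case=> [] [-> -> ->].
Qed.

Lemma tau_quad k : node n k -> forall h s t, valid n s t -> ~~ simple k h s t ->
  tau k (tau k (x h s t)) = (1 - rho ^+ 2) *: tau k (x h s t) + rho ^+ 2 *: x h s t.
Proof.
move=> nk h s t v; case: (nodeP n2 h nk v) => [->//|h' s' t' st|h' s' t' st|f] _.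
- rewrite (ruleD rules st) linearZ /= (ruleU rules st); lmod.
- rewrite (ruleU rules st) linearD !linearZ /= (ruleU rules st) (ruleD rules st); lmod.
- rewrite !(ruleF rules nk v f); lmod.
Qed.

End TauRel.

(** * Rank one perturbations of tau *)

Section Pairing.
Variables (F : fieldType) (n : nat) (c : Dn_idx n -> F).
(** The linear functional with given values on the basis. *)
Definition pairing (v : Dn_space F n) : F := \sum_b v b * c b.

Fact pairing_is_linear : linear_for *%R pairing.
Proof.
move=> a u v; rewrite /pairing mulr_sumr -big_split; apply: eq_bigr => b _.
by rewrite !ffunE mulrDl mulrA.
Qed.
HB.instance Definition _ := GRing.isLinear.Build F (Dn_space F n) F *%R pairing
  pairing_is_linear.

Lemma pairing_w b : pairing (w F n (flag b) (lo b) (hi b)) = c b.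
Proof.
rewrite /pairing (bigD1 b) //= w_idx ffunE eqxx mul1r big1 ?addr0 // => d db.
by rewrite ffunE (negPf db) mul0r.
Qed.

Lemma linext_rank1 (z : Dn_space F n) (v : Dn_space F n) :
  (linext (fun b => c b *: z) : 'End(Dn_space F n)) v = pairing v *: z.
Proof.
rewrite [v]w_sum linear_sum linear_sum scaler_suml; apply: eq_bigr => b _.
by rewrite w_idx !linearZ /= linextE -w_idx pairing_w scalerA.
Qed.

End Pairing.

Section SigmaRel.
Variables (F : fieldType) (n : nat).
Hypothesis n2 : (1 < n)%N.
Variables (rho t : F) (tau : nat -> 'End(Dn_space F n)).
Hypothesis rho0 : rho != 0.
Hypothesis rules : tau_rules rho tau.
Variable f : nat -> {scalar Dn_space F n}.

Notation x := (w F n).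
Notation xa := (xa F n).

(** The linear system for the functionals f_k = T_k that makes the sigma_k satisfy
    the Artin relations. *)
Record T_rules : Prop := TRules {
  T_diag : forall k, node n k -> f k (xa k) = rho ^+ 4;
  T_simple : forall i j, node n i -> node n j -> i != j -> f i (xa j) = 0;
  T_comm : forall i j, node n i -> node n j -> i != j -> ~~ Dn_adj i j ->
    forall v, f i (tau j v) = f i v;
  T_adj : forall i j, node n i -> node n j -> i != j -> Dn_adj i j ->
    forall v, f j (tau i v) = f i (tau j v) }.
Hypothesis Trules : T_rules.

(** The map sigma_k = tau_k + t f_k x_(alpha_k). *)
Definition sigma k (v : Dn_space F n) : Dn_space F n :=
  tau k v + (t * f k v) *: xa k.

Lemma sigmaZ k a v : sigma k (a *: v) = a *: sigma k v.
Proof. by rewrite /sigma !linearZ /=; lmod. Qed.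

Lemma tau_xa_comm i j : node n i -> node n j -> i != j -> ~~ Dn_adj i j ->
  tau i (xa j) = xa j.
Proof.
move=> ni nj ij nadj; have [h [s [r [v sm]]]] := simple_ex n2 nj.
rewrite (xa_simple F n2 nj v sm) (ruleF rules ni v) //.
have c : dot (alpha n j) (alpha n i) = 0 by rewrite dotC dot_cartan // (negPf nadj).
exact: (orth_fixed n2 nj ni c v sm).
Qed.

(** The span of x_(alpha_i), x_(alpha_j) and y = x_(alpha_i + alpha_j) under tau_i and
    tau_j, for adjacent i and j. *)
Lemma sum_vec i j : node n i -> node n j -> i != j -> Dn_adj i j ->
  exists y, [/\ tau i (xa j) = (1 - rho ^+ 2) *: xa j + rho *: y,
    tau j (xa i) = (1 - rho ^+ 2) *: xa i + rho *: y,
    tau i y = rho *: xa j, tau j y = rho *: xa i &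
    exists h s r, [/\ y = x h s r, valid n s r, ~~ simple i h s r & ~~ simple j h s r]].
Proof.
move=> ni nj ij adj; have [h [s [r [v si]]]] := simple_ex n2 ni.
have [h1 [s1 [r1 [h2 [s2 [r2 [st1 st2 sj]]]]]]] := sum_labels n2 ni nj ij adj v si.
have [_ v1 v2] := step_valid n2 st2.
exists (x h1 s1 r1); rewrite (xa_simple F n2 ni v si) (xa_simple F n2 nj v2 sj).
split; rewrite ?(ruleU rules st1) ?(ruleU rules st2) ?(ruleD rules st1) ?(ruleD rules st2) //.
exists h1, s1, r1; split=> //.
  by rewrite -(dot_eq2 n2 h1 ni v1); have [-> _] := step_dot n2 st2.
rewrite -(dot_eq2 n2 h1 nj v1).
by have [-> _] := step_dot n2 st1.
Qed.

Lemma f_sum i j y : node n i -> node n j -> i != j -> Dn_adj i j ->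
  tau j (xa i) = (1 - rho ^+ 2) *: xa i + rho *: y -> f i y = (rho ^+ 2 - 1) * rho ^+ 3.
Proof.
move=> ni nj ij adj ey; have := T_adj Trules ni nj ij adj (xa i).
rewrite ey (tau_xa n2 rules ni) linear0 linearD !linearZ /= T_diag // => e.
apply: (mulfI rho0); apply/eqP; rewrite -subr_eq0; apply/eqP.
transitivity ((1 - rho ^+ 2) * rho ^+ 4 + rho * f i y); last by rewrite -e.
ring.
Qed.

(** This holds since tau_j is a root of X^2 - (1 - rho^2) X - rho^2 away from
    alpha_j, where both sides vanish. *)
Lemma f_L3 i j v : node n i -> node n j -> i != j -> Dn_adj i j ->
  f j (tau i (tau j v)) = (1 - rho ^+ 2) * f j (tau i v) + rho ^+ 2 * f i v.
Proof.
move=> ni nj ij adj.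
have lin1 : linear_for *%R (fun u => f j (tau i (tau j u))).
  by move=> a u u'; rewrite !linearP.
have lin2 : linear_for *%R (fun u => (1 - rho ^+ 2) * f j (tau i u) + rho ^+ 2 * f i u).
  by move=> a u u'; rewrite !linearP /=; ring.
move: v; apply: (w_ext (W := F^o) lin1 lin2) => h s r v.
case sj : (simple j h s r).
  rewrite (ruleS rules nj v sj) !linear0 (T_adj Trules ni nj ij adj).
  rewrite (ruleS rules nj v sj) linear0 -(xa_simple F n2 nj v sj) (T_simple Trules) //.
  by rewrite !mulr0 addr0.
rewrite !(T_adj Trules ni nj ij adj) (tau_quad n2 rules) ?sj //.
by rewrite linearD !linearZ.
Qed.

Lemma sigma_comm i j v : node n i -> node n j -> i != j -> ~~ Dn_adj i j ->
  sigma i (sigma j v) = sigma j (sigma i v).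
Proof.
move=> ni nj ij nadj; have ji : j != i by rewrite eq_sym.
have nadj' : ~~ Dn_adj j i by rewrite /Dn_adj orbC.
rewrite /sigma !linearD !linearZ /= !(T_simple Trules) // !(T_comm Trules) //.
rewrite !tau_xa_comm // (tau_comm n2 rules ni nj) //; lmod.
Qed.

Lemma sigma_braid i j v : node n i -> node n j -> i != j -> Dn_adj i j ->
  sigma i (sigma j (sigma i v)) = sigma j (sigma i (sigma j v)).
Proof.
move=> ni nj ij adj; have ji : j != i by rewrite eq_sym.
have adj' : Dn_adj j i by rewrite /Dn_adj orbC.
have [y [e1 e2 e3 e4 _]] := sum_vec ni nj ij adj.
have fi := f_sum ni nj ij adj e2; have fj := f_sum nj ni ji adj' e1.
rewrite /sigma; do 3! rewrite ?linearD ?linearZ /=.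
rewrite !e1 !e2; do 2! rewrite ?linearD ?linearZ /=.
rewrite !e3 !e4 !(tau_xa n2 rules) // ?linearD ?linearZ /= !f_L3 //.
rewrite !(T_diag Trules) // !(T_simple Trules) // fi fj (T_adj Trules ni nj) //.
rewrite (tau_braid n2 rules ni nj ij adj).
lmod.
Qed.

End SigmaRel.

(** * Existence of the Cohen-Wales family *)

Section Existence.
Variables (F : fieldType) (n : nat).
Hypothesis n2 : (1 < n)%N.
Variables (rho : F) (tau : nat -> 'End(Dn_space F n)).
Hypothesis rho0 : rho != 0.
Hypothesis rules : tau_rules rho tau.

Notation x := (w F n).

(** The functional T_k of the explicit table. *)
Definition cwf (k : nat) : {scalar Dn_space F n} :=
  pairing (fun b : Dn_idx n => cwT rho k (flag b) (lo b) (hi b)).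

Lemma cwf_w k h s r : valid n s r -> cwf k (x h s r) = cwT rho k h s r.
Proof. by case/(idx_of h) => b [<- <- <-]; rewrite /cwf /= pairing_w. Qed.

Lemma cwf_rules : T_rules rho tau cwf.
Proof.
split=> [k nk|i j ni nj ij|i j ni nj ij nadj|i j ni nj ij adj].
- have [h [s [r [v sm]]]] := simple_ex n2 nk.
  by rewrite (xa_simple F n2 nk v sm) cwf_w // (cwT_simple n2).
- have [h [s [r [v sm]]]] := simple_ex n2 nj.
  by rewrite (xa_simple F n2 nj v sm) cwf_w // (cwT_simple_other n2 rho0 ni nj).
- have lin1 : linear_for *%R (fun u => cwf i (tau j u)) by move=> a u u'; rewrite !linearP.
  have lin2 : linear_for *%R (cwf i) by move=> a u u'; rewrite !linearP.
  apply: (w_ext (W := F^o) lin1 lin2) => h s r v.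
  case: (nodeP n2 h nj v) => [sj|h' s' r' st|h' s' r' st|fj].
  + rewrite (ruleS rules nj v sj) linear0 cwf_w //.
    by rewrite (cwT_simple_other n2 rho0 ni nj).
  + have [_ _ v'] := step_valid n2 st.
    rewrite (ruleD rules st) linearZ /= !cwf_w //.
    by rewrite (cwT_commute n2 rho0 ni ij nadj st).
  + have [_ v' _] := step_valid n2 st.
    rewrite (ruleU rules st) linearD !linearZ /= !cwf_w //.
    rewrite (cwT_commute n2 rho0 ni ij nadj st); ring.
  by rewrite (ruleF rules nj v fj).
have ji : j != i by rewrite eq_sym.
have adj' : Dn_adj j i by rewrite /Dn_adj orbC.
have lin1 : linear_for *%R (fun u => cwf j (tau i u)) by move=> a u u'; rewrite !linearP.
have lin2 : linear_for *%R (fun u => cwf i (tau j u)) by move=> a u u'; rewrite !linearP.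
apply: (w_ext (W := F^o) lin1 lin2) => h s r v.
have A a b h0 s0 r0 : node n a -> node n b -> a != b -> Dn_adj a b -> valid n s0 r0 ->
    simple a h0 s0 r0 -> cwf a (tau b (x h0 s0 r0)) = 0.
  move=> na nb ab adj0 v0 sa.
  have [h1 [s1 [t1 [h2 [s2 [t2 [st1 st2 sb]]]]]]] := sum_labels n2 na nb ab adj0 v0 sa.
  have [_ v1 _] := step_valid n2 st1.
  rewrite (ruleU rules st1) linearD !linearZ /= !cwf_w // (cwT_simple n2 rho0 na) //.
  rewrite (cwT_sum n2 rho0 adj0 st2 sb); ring.
have C a b h0 s0 t0 h1 s1 t1 h2 s2 t2 : node n a -> node n b ->
    a != b -> Dn_adj a b -> step n a h1 s1 t1 h0 s0 t0 -> step n b h2 s2 t2 h1 s1 t1 ->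
    [/\ cwf b (tau a (x h0 s0 t0)) = cwf a (tau b (x h0 s0 t0)),
        cwf b (tau a (x h1 s1 t1)) = cwf a (tau b (x h1 s1 t1)) &
        cwf b (tau a (x h2 s2 t2)) = cwf a (tau b (x h2 s2 t2))].
  move=> na nb ab adj0 st1 st2; have [f0 f2] := chain_fixed n2 ab adj0 st1 st2.
  have [_ v1 v0] := step_valid n2 st1; have [_ v2 _] := step_valid n2 st2.
  have [E0 E1 E2] := cwT_chain n2 rho0 adj0 st1 st2.
  split.
  - by rewrite (ruleU rules st1) (ruleF rules nb v0 f0) linearD !linearZ /= !cwf_w.
  - by rewrite (ruleD rules st1) (ruleU rules st2) linearD !linearZ /= !cwf_w.
  - by rewrite (ruleF rules na v2 f2) (ruleD rules st2) !linearZ /= !cwf_w.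
case: (A2P n2 h ni nj ij adj v) => [si|sj|h1 s1 t1 h2 s2 t2 st1 sj st2 si|fi fj|].
- by rewrite (ruleS rules ni v si) linear0 A.
- by rewrite (ruleS rules nj v sj) linear0 A.
- have [_ _ v1] := step_valid n2 st1; have [_ _ v2] := step_valid n2 st2.
  rewrite (ruleD rules st1) (ruleD rules st2) !linearZ /= !cwf_w //.
  by rewrite (cwT_simple n2 rho0 ni v2 si) (cwT_simple n2 rho0 nj v1 sj).
- rewrite (ruleF rules ni v fi) (ruleF rules nj v fj) !cwf_w //.
  by rewrite (cwT_fixed n2 rho0 adj v fi fj).
move=> a b h0 s0 t0 h1 s1 t1 h2 s2 t2 [] [-> ->] st1 st2.
  by have [? ? ?] := C _ _ _ _ _ _ _ _ _ _ _ ni nj ij adj st1 st2; case=> [] [-> -> ->].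
by have [? ? ?] := C _ _ _ _ _ _ _ _ _ _ _ nj ni ji adj' st1 st2; case=> [] [-> -> ->].
Qed.

End Existence.

(** * Uniqueness of the Cohen-Wales family *)

Section Uniqueness.
Variables (F : fieldType) (n : nat).
Hypothesis n2 : (1 < n)%N.
Variables (rho : F) (tau : nat -> 'End(Dn_space F n)).
Hypothesis rho0 : rho != 0.
Hypothesis rules : tau_rules rho tau.

Notation x := (w F n).

Lemma T_rules_unique (f g : nat -> {scalar Dn_space F n}) :
  T_rules rho tau f -> T_rules rho tau g ->
  forall k h s r, node n k -> valid n s r -> f k (x h s r) = g k (x h s r).
Proof.
move=> Rf Rg k h s r nk v.
have [N] := ubnP (ht h s r); elim: N k h s r nk v => // N IH k h s r nk v; rewrite ltnS => hN.
have low j a s' r' : node n j -> valid n s' r' -> (ht a s' r' < ht h s r)%N ->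
  f j (x a s' r') = g j (x a s' r').
  by move=> nj v' lt; apply: IH => //; exact: leq_trans lt hN.
have smp j : node n j -> simple j h s r -> f k (x h s r) = g k (x h s r).
  move=> nj sj; rewrite -(xa_simple F n2 nj v sj); case: (k =P j) => [->|/eqP kj].
    by rewrite (T_diag Rf) // (T_diag Rg).
  by rewrite (T_simple Rf) // (T_simple Rg).
case s1 : (simple r h s r).
  by apply: smp s1; move: v; rewrite /node /valid; lia.
case s2 : (simple 1 h s r); first by apply: smp s2; rewrite /node; lia.
case: (descent n2 nk v (negbT s1) (negbT s2)) => [[j [h' [s' [r' [jk st]]]]]|].
  have [nj _ v'] := step_valid n2 st; have lt := step_ht n2 st.
  have kj : k != j by rewrite eq_sym.
  case adj : (Dn_adj k j); last first.
    have ef := T_comm Rf nk nj kj (negbT adj) (x h s r).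
    have eg := T_comm Rg nk nj kj (negbT adj) (x h s r).
    rewrite (ruleD rules st) linearZ /= in ef; rewrite (ruleD rules st) linearZ /= in eg.
    by rewrite -ef -eg low.
  have ef := T_adj Rf nk nj kj adj (x h' s' r').
  have eg := T_adj Rg nk nj kj adj (x h' s' r').
  rewrite (ruleU rules st) linearD !linearZ /= in ef.
  rewrite (ruleU rules st) linearD !linearZ /= in eg.
  suff E : f j (tau k (x h' s' r')) = g j (tau k (x h' s' r')).
    by apply: (mulfI rho0); move: ef; rewrite E eg (low k h') // => /addrI.
  case: (nodeP n2 h' nk v') => [sk|h3 s3 r3 st3|h3 s3 r3 st3|fk].
  - by rewrite (ruleS rules nk v' sk) !linear0.
  - have [_ _ v3] := step_valid n2 st3.
    rewrite (ruleD rules st3) !linearZ /= low //.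
    exact: ltn_trans (step_ht n2 st3) lt.
  - have [_ p] := step_dot n2 st3; have := dot_bounds n2 h nk v; rewrite /=.
    move: p; rewrite (dot_step n2 k st) dot_cartan // adj => p; lia.
  by rewrite (ruleF rules nk v' fk) low.
move=> [j [h' [s' [r' [nj adj kj fj st]]]]].
have [_ _ v'] := step_valid n2 st; have lt := step_ht n2 st.
have ef := T_adj Rf nk nj kj adj (x h s r).
have eg := T_adj Rg nk nj kj adj (x h s r).
rewrite (ruleD rules st) (ruleF rules nj v fj) linearZ /= in ef.
rewrite (ruleD rules st) (ruleF rules nj v fj) linearZ /= in eg.
by rewrite -ef -eg low.
Qed.

End Uniqueness.

(** * The Artin relations force the rank one conditions *)

Section Laurent.
Variables (F : fieldType) (rho : F).
Hypothesis rho0 : rho != 0.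

Lemma laurent_add a b : int_laurent rho a -> int_laurent rho b -> int_laurent rho (a + b).
Proof.
move=> [p [d ->]] [q [e ->]]; exists (p * 'X^e + q * 'X^d), (d + e)%N.
rewrite rmorphD !rmorphM /= !map_polyXn !hornerE ?hornerXn exprD.
by field; rewrite !expf_neq0.
Qed.

Lemma laurent_mul a b : int_laurent rho a -> int_laurent rho b -> int_laurent rho (a * b).
Proof.
move=> [p [d ->]] [q [e ->]]; exists (p * q), (d + e)%N.
rewrite rmorphM /= hornerM exprD.
by field; rewrite !expf_neq0.
Qed.

Lemma laurent_1 : int_laurent rho 1.
Proof. by exists 1, 0%N; rewrite rmorph1 hornerE divr1. Qed.

Lemma laurent_opp a : int_laurent rho a -> int_laurent rho (- a).
Proof. by move=> [p [d ->]]; exists (- p), d; rewrite rmorphN hornerN mulNr. Qed.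

Lemma laurent_0 : int_laurent rho 0.
Proof. by rewrite -(subrr 1); exact: laurent_add laurent_1 (laurent_opp laurent_1). Qed.

Lemma laurent_rho : int_laurent rho rho.
Proof. by exists 'X, 0%N; rewrite map_polyX hornerX divr1. Qed.

Lemma laurent_inv k : int_laurent rho (rho ^+ k)^-1.
Proof. by exists 1, k; rewrite rmorph1 hornerE div1r. Qed.

Lemma laurent_exp a k : int_laurent rho a -> int_laurent rho (a ^+ k).
Proof.
move=> la; elim: k => [|k IH]; first exact: laurent_1.
by rewrite exprS; exact: laurent_mul.
Qed.

End Laurent.

Ltac laurent := repeat first
  [ assumption | apply laurent_0 | apply laurent_1 | apply laurent_rho | apply laurent_inv
  | apply laurent_add | apply laurent_mul | apply laurent_opp | apply laurent_exp ].

Lemma cwT_laurent (F : fieldType) (rho : F) : rho != 0 ->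
  forall k h s t, int_laurent rho (cwT rho k h s t).
Proof.
move=> rho0 k h s t; have inv1 : int_laurent rho rho^-1 by exact: (laurent_inv rho 1).
by rewrite /cwT /pw; do ! case: ifP => _; laurent.
Qed.

Section Necessity.
Variables (F : fieldType) (n : nat).
Hypothesis n2 : (1 < n)%N.
Variables (rho t : F) (tau : nat -> 'End(Dn_space F n)).
Hypothesis rho0 : rho != 0.
Hypothesis rules : tau_rules rho tau.
Hypothesis indep : forall a b, int_laurent rho a -> int_laurent rho b ->
  a + t * b = 0 -> a = 0 /\ b = 0.
Variable f : nat -> {scalar Dn_space F n}.

Notation x := (w F n).
Notation xa := (xa F n).
Notation sigma := (sigma t tau f).

Hypothesis f_laurent : forall k h s r, node n k -> valid n s r ->
  int_laurent rho (f k (x h s r)).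
Hypothesis f_diag : forall k, node n k -> f k (xa k) = rho ^+ 4.
Hypothesis braid : forall i j v, node n i -> node n j -> Dn_adj i j ->
  sigma i (sigma j (sigma i v)) = sigma j (sigma i (sigma j v)).
Hypothesis comm : forall i j v, node n i -> node n j -> i != j -> ~~ Dn_adj i j ->
  sigma i (sigma j v) = sigma j (sigma i v).

Let t0 : t != 0.
Proof.
apply/eqP => t0; have [|_ /eqP] := indep (laurent_0 rho0) (laurent_1 rho); first by rewrite t0 mul0r addr0.
by rewrite oner_eq0.
Qed.

Let t4 : t * rho ^+ 4 != 1.
Proof.
apply/eqP => e; have l1 : int_laurent rho (- 1) by laurent.
have l4 : int_laurent rho (rho ^+ 4) by laurent.
have [|/eqP] := indep l1 l4; first by rewrite e addNr.
by rewrite oppr_eq0 oner_eq0.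
Qed.

Let t4' : t * rho ^+ 4 != - rho ^+ 2.
Proof.
apply/eqP => e; have l2 : int_laurent rho (rho ^+ 2) by laurent.
have l4 : int_laurent rho (rho ^+ 4) by laurent.
have [|/eqP] := indep l2 l4; first by rewrite e subrr.
by rewrite expf_eq0 (negPf rho0).
Qed.

Lemma xa_label k : node n k -> exists h s r, [/\ valid n s r, simple k h s r & xa k = x h s r].
Proof.
move=> nk; have [h [s [r [v sm]]]] := simple_ex n2 nk.
by exists h, s, r; split=> //; apply: xa_simple.
Qed.

Lemma f_xa_laurent i j : node n i -> node n j -> int_laurent rho (f i (xa j)).
Proof. by move=> ni /xa_label [h [s [r [v _ ->]]]]; apply: f_laurent. Qed.

Lemma simple_uniq i j h s r : node n i -> node n j -> valid n s r ->
  simple i h s r -> simple j h s r -> i = j.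
Proof. by rewrite /node /simple => ni nj v; case: (i =P 1%N) => i1; case: (j =P 1%N) => j1; case: h => //= *; lia. Qed.

Lemma free2 i j a b : node n i -> node n j -> i != j ->
  a *: xa i + b *: xa j = 0 -> a = 0 /\ b = 0.
Proof.
move=> ni nj ij; have [hi [s_i [ri [vi smi ->]]]] := xa_label ni.
have [hj [s_j [rj [vj smj ->]]]] := xa_label nj.
case/(idx_of hi): (vi) => bi [e1 e2 e3]; case/(idx_of hj): (vj) => bj [e4 e5 e6].
move: smi smj vi vj; rewrite -e1 -e2 -e3 -e4 -e5 -e6 !w_idx.
move=> smi smj vi vj /ffunP E.
have ne1 : bi != bj by apply: contra ij => /eqP e; subst bj; apply/eqP/(simple_uniq ni nj vi smi smj).
split.
- by move: (E bi); rewrite !ffunE eqxx (negPf ne1) /GRing.scale /= mulr0 addr0 mulr1.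
- by move: (E bj); rewrite !ffunE eqxx eq_sym (negPf ne1) /GRing.scale /= mulr0 add0r mulr1.
Qed.

Lemma free3 i j y h s r a b c : node n i -> node n j -> i != j ->
  y = x h s r -> valid n s r -> ~~ simple i h s r -> ~~ simple j h s r ->
  a *: xa i + b *: xa j + c *: y = 0 -> [/\ a = 0, b = 0 & c = 0].
Proof.
move=> ni nj ij -> v si sj.
have [hi [s_i [ri [vi smi ->]]]] := xa_label ni.
have [hj [s_j [rj [vj smj ->]]]] := xa_label nj.
case/(idx_of hi): (vi) => bi [e1 e2 e3]; case/(idx_of hj): (vj) => bj [e4 e5 e6].
case/(idx_of h): (v) => b0 [e7 e8 e9].
move: smi smj si sj vi vj v; rewrite -e1 -e2 -e3 -e4 -e5 -e6 -e7 -e8 -e9 !w_idx.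
move=> smi smj si sj vi vj v /ffunP E.
have ne1 : bi != bj by apply: contra ij => /eqP e; subst bj; apply/eqP/(simple_uniq ni nj vi smi smj).
have ne2 : bi != b0 by apply: contra si => /eqP <-.
have ne3 : bj != b0 by apply: contra sj => /eqP <-.
split.
- move: (E bi); rewrite !ffunE eqxx (negPf ne1) (negPf ne2) /GRing.scale /=.
  by rewrite !mulr0 !addr0 mulr1.
- move: (E bj); rewrite !ffunE eqxx eq_sym (negPf ne1) (negPf ne3) /GRing.scale /=.
  by rewrite !mulr0 !addr0 add0r mulr1.
- move: (E b0); rewrite !ffunE eqxx eq_sym (negPf ne2) eq_sym (negPf ne3) /GRing.scale /=.
  by rewrite !mulr0 !add0r mulr1.
Qed.

(** The first claim is the coefficient of x_(alpha_i) in the commutation relation at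
    x_(alpha_j), which reads (t rho^4 - 1) f_i(x_(alpha_j)) = 0. *)
Lemma necessity_comm i j : node n i -> node n j -> i != j -> ~~ Dn_adj i j ->
  f i (xa j) = 0 /\ forall v, f i (tau j v) = f i v.
Proof.
move=> ni nj ij nadj; have ji : j != i by rewrite eq_sym.
have nadj' : ~~ Dn_adj j i by rewrite /Dn_adj orbC.
have E v : f i (tau j v) + t * f j v * f i (xa j) = f i v.
  have := comm v ni nj ij nadj.
  rewrite /sigma !linearD !linearZ /= (tau_xa_comm n2 rules ni nj) //.
  rewrite (tau_xa_comm n2 rules nj ni) // (tau_comm n2 rules ni nj) // => e.
  have := free2 (a := t * (f i (tau j v) + t * f j v * f i (xa j)) - t * f i v)
    (b := t * f j v - t * (f j (tau i v) + t * f i v * f j (xa i))) ni nj ij.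
  case; last by move=> e' _; apply: (mulfI t0); apply/eqP; rewrite -subr_eq0 e'.
  by move/eqP: e; rewrite -subr_eq0 => /eqP <-; lmod.
have c0 : f i (xa j) = 0.
  have := E (xa j); rewrite (tau_xa n2 rules nj) linear0 add0r f_diag // => e.
  apply/eqP; have /eqP : (t * rho ^+ 4 - 1) * f i (xa j) = 0 by rewrite mulrBl e; ring.
  by rewrite mulf_eq0 subr_eq0 (negPf t4).
by split=> // v; rewrite -[RHS]E c0 mulr0 addr0.
Qed.

(** Coefficients of x_(alpha_i + alpha_j) and x_(alpha_i) in the braid relation
    applied to v; Y is the value of f_i at alpha_i + alpha_j. *)
Lemma braid_coef i j v : node n i -> node n j -> i != j -> Dn_adj i j ->
  let cij := f i (xa j) in let cji := f j (xa i) in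
  exists Y, [/\ int_laurent rho Y,
   f i (tau j (xa i)) = (1 - rho ^+ 2) * rho ^+ 4 + rho * Y,
   f j (tau i v) + t * f i v * cji = f i (tau j v) + t * f j v * cij &
   t * (f i (tau j (tau i v)) + t * f i v * ((1 - rho ^+ 2) * rho ^+ 4 + rho * Y)
        + (t * f j (tau i v) + t ^+ 2 * f i v * cji) * cij)
   = t * rho ^+ 2 * f j v
     + (1 - rho ^+ 2) * (t * f i (tau j v) + t ^+ 2 * f j v * cij)].
Proof.
move=> ni nj ij adj cij cji.
have [y [e1 e2 e3 e4 [h [s [r [ey v0 si sj]]]]]] := sum_vec n2 rules ni nj ij adj.
exists (f i y); split.
- by rewrite ey; apply: f_laurent.
- by rewrite e2 linearD !linearZ /= f_diag.
all: have := braid v ni nj adj.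
all: rewrite /sigma; do 3! rewrite ?linearD ?linearZ /=.
all: rewrite !e1 !e2; do 2! rewrite ?linearD ?linearZ /=.
all: rewrite !e3 !e4 !(tau_xa n2 rules) // ?linearD ?linearZ /=.
all: rewrite !f_diag // (tau_braid n2 rules ni nj ij adj) -/cij -/cji.
all: move/eqP; rewrite -subr_eq0 => /eqP E.
all: have [] := free3 (y := y)
  (a := t * (f i (tau j (tau i v)) + t * f i v * ((1 - rho ^+ 2) * rho ^+ 4 + rho * f i y)
     + (t * f j (tau i v) + t ^+ 2 * f i v * cji) * cij)
     - (t * rho ^+ 2 * f j v + (1 - rho ^+ 2) * (t * f i (tau j v) + t ^+ 2 * f j v * cij)))
  (b := - (t * (f j (tau i (tau j v)) + t * f j v * ((1 - rho ^+ 2) * rho ^+ 4 + rho * f j y)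
     + (t * f i (tau j v) + t ^+ 2 * f j v * cij) * cji)
     - (t * rho ^+ 2 * f i v + (1 - rho ^+ 2) * (t * f j (tau i v) + t ^+ 2 * f i v * cji))))
  (c := rho * t * (f j (tau i v) + t * f i v * cji - (f i (tau j v) + t * f j v * cij)))
  ni nj ij ey v0 si sj.
1,3: by rewrite -E; lmod.
- by move=> _ _ /eqP; rewrite !mulf_eq0 (negPf rho0) (negPf t0) subr_eq0 => /eqP.
- by move=> /eqP; rewrite subr_eq0 => /eqP.
Qed.

(** At v = x_(alpha_i) the first coefficient gives c c' = rho^4 c' for
    c = f_i(x_(alpha_j)) and c' = f_j(x_(alpha_i)), and the second one becomes
    c' (t rho^4 - 1) (t rho^4 + rho^2) = 0. *)
Lemma necessity_half i j : node n i -> node n j -> i != j -> Dn_adj i j -> f j (xa i) = 0.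
Proof.
move=> ni nj ij adj.
have [Y [lY e1 e2 e3]] := braid_coef (xa i) ni nj ij adj.
rewrite (tau_xa n2 rules ni) !linear0 e1 !f_diag // in e2 e3.
set cij := f i (xa j) in e2 e3; set cji := f j (xa i) in e2 e3 *.
have l1 : int_laurent rho cij by apply: f_xa_laurent.
have l2 : int_laurent rho cji by apply: f_xa_laurent.
have la : int_laurent rho ((1 - rho ^+ 2) * rho ^+ 4 + rho * Y) by laurent.
have lb : int_laurent rho (cji * cij - rho ^+ 4 * cji) by laurent.
have [|a0 b0] := indep la lb.
  transitivity ((1 - rho ^+ 2) * rho ^+ 4 + rho * Y + t * cji * cij - (0 + t * rho ^+ 4 * cji)).
    ring.
  by rewrite e2 subrr.
have cc : cji * cij = rho ^+ 4 * cji by apply/eqP; rewrite -subr_eq0 b0.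
rewrite a0 in e3.
have : t * cji * ((t * rho ^+ 4 - 1) * (t * rho ^+ 4 + rho ^+ 2)) = 0.
  transitivity (t ^+ 3 * rho ^+ 4 * (rho ^+ 4 * cji)
    - (t * rho ^+ 2 * cji + (1 - rho ^+ 2) * (t ^+ 2 * (rho ^+ 4 * cji)))); first ring.
  rewrite -cc; apply/eqP; rewrite subr_eq0; apply/eqP.
  transitivity (t * (0 + t * rho ^+ 4 * 0 + (t * 0 + t ^+ 2 * rho ^+ 4 * cji) * cij)); first ring.
  rewrite e3; ring.
move/eqP; rewrite !mulf_eq0 (negPf t0) subr_eq0 (negPf t4) /= addr_eq0 (negPf t4') orbF.
by move/eqP.
Qed.

Lemma necessity_adj i j : node n i -> node n j -> i != j -> Dn_adj i j ->
  f i (xa j) = 0 /\ forall v, f j (tau i v) = f i (tau j v).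
Proof.
move=> ni nj ij adj; have ji : j != i by rewrite eq_sym.
have adj' : Dn_adj j i by rewrite /Dn_adj orbC.
have c1 := necessity_half ni nj ij adj; have c2 := necessity_half nj ni ji adj'.
split=> // v; have [Y [_ _ e _]] := braid_coef v ni nj ij adj.
by move: e; rewrite c1 c2 !mulr0 !addr0.
Qed.

Lemma necessity : T_rules rho tau f.
Proof.
split=> // i j ni nj ij.
- case adj : (Dn_adj i j); first by have [] := necessity_adj ni nj ij adj.
  by have [] := necessity_comm ni nj ij (negbT adj).
- by move=> nadj; have [] := necessity_comm ni nj ij nadj.
- by move=> adj; have [] := necessity_adj ni nj ij adj.
Qed.

End Necessity.

(** * Words in the generators *)

Section Words.
Variables (F : fieldType) (n : nat) (l r : F).
Hypothesis r0 : r != 0.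
Hypothesis l0 : l != 0.
Let m : F := r^-1 - r.
Notation W := (Dn_space F n).
Variables (S : nat -> 'End(W)) (xs : nat -> W).

(** The operator S_k^2 + m S_k - 1, a scalar multiple of the image of e_k. *)
Definition Epol k (v : W) : W := S k (S k v) + m *: S k v - v.

(** What is needed of the operators S_k and of the vectors xs_k = x_(alpha_k) to
    derive the formulas that define nu. *)
Record words_rules : Prop := WordsRules {
  Wcomm : forall i j v, node n i -> node n j -> i != j -> ~~ Dn_adj i j ->
    S i (S j v) = S j (S i v);
  Wbraid : forall i j v, node n i -> node n j -> Dn_adj i j ->
    S i (S j (S i v)) = S j (S i (S j v));
  Winj : forall k u v, node n k -> S k u = S k v -> u = v;
  Wxx : forall k, node n k -> S k (xs k) = l^-1 *: xs k;
  Wxc : forall i j, node n i -> node n j -> i != j -> ~~ Dn_adj i j ->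
    S i (xs j) = r *: xs j;
  Wxb : forall i j, node n i -> node n j -> Dn_adj i j -> S i (S j (xs i)) = xs j;
  WE1 : forall k j, node n k -> node n j -> Dn_adj k j -> Epol k (xs j) = (m / l) *: xs k;
  WE2 : forall k j, node n k -> node n j -> Dn_adj k j -> Epol k (S j (xs k)) = m *: xs k }.
Hypothesis rules : words_rules.

Notation P := (pw r).

Lemma EpolZ k a v : Epol k (a *: v) = a *: Epol k v.
Proof. rewrite /Epol !linearZ /=; lmod. Qed.

Lemma SS k v : S k (S k v) = v - m *: S k v + Epol k v.
Proof. rewrite /Epol; lmod. Qed.

Lemma Epol_comm i k v : node n i -> node n k -> i != k -> ~~ Dn_adj i k ->
  Epol k (S i v) = S i (Epol k v).
Proof.
move=> ni nk ik nadj; rewrite /Epol linearB linearD linearZ /=.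
by rewrite !(Wcomm rules _ ni nk).
Qed.

Lemma Epol_braid k j v : node n k -> node n j -> Dn_adj k j ->
  Epol k (S j (S k v)) = S j (S k (Epol j v)).
Proof.
move=> nk nj adj; have adj' : Dn_adj j k by rewrite /Dn_adj orbC.
rewrite /Epol !(linearD, linearN, linearZ) /=.
by rewrite !(Wbraid rules _ nk nj adj).
Qed.

(** The vector S_t ... S_(a+2) S_(a+1) v. *)
Fixpoint up (a t : nat) (v : W) : W :=
  if t is t'.+1 then if (t' < a)%N then v else S t (up a t' v) else v.

Lemma upS a t v : (a <= t)%N -> up a t.+1 v = S t.+1 (up a t v).
Proof. by move=> at_; rewrite /= ltnNge at_. Qed.

Lemma upnn a v : up a a v = v.
Proof. by case: a => //= a; rewrite ltnS leqnn. Qed.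

(** The images of w_(s,t) and of \hat w_(s,t) under the intertwiner. *)
Definition zF s t := up s.+1 t (xs s.+1).
Definition zT s t := up 1 s (up 2 t (xs 1)).
Definition z (h : bool) s t := if h then zT s t else zF s t.

Lemma zF0 s : zF s s.+1 = xs s.+1.
Proof. exact: upnn. Qed.
Lemma zFS s t : (s < t)%N -> zF s t.+1 = S t.+1 (zF s t).
Proof. exact: upS. Qed.
Lemma zT0 : zT 1 2 = xs 1.
Proof. by []. Qed.
Lemma zT1S t : (1 < t)%N -> zT 1 t.+1 = S t.+1 (zT 1 t).
Proof. by move=> t1; rewrite /zT !upnn upS. Qed.
Lemma zTS s t : (0 < s)%N -> zT s.+1 t = S s.+1 (zT s t).
Proof. exact: upS. Qed.

(** A form of [fixed] without conditional expressions. *)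
Lemma fixedB k h s t : fixed k h s t =
  (k == 1%N) && ((2 < s)%N || [&& ~~ h, s == 1%N & t == 2%N]) ||
  (k != 1%N) && ([&& s.+1 != k, s != k, t.+1 != k & t != k] || [&& h, s.+1 == k & t == k]).
Proof. by rewrite /fixed; case: (k == 1%N); rewrite /= ?orbF. Qed.

(** Solves side conditions on labels. *)
Ltac nd := solve [repeat match goal with
  | H : is_true (node _ _) |- _ => unfold node in H
  | H : is_true (valid _ _ _) |- _ => unfold valid in H
  | H : is_true (fixed _ _ _ _) |- _ => rewrite fixedB in H
  | H : is_true (Dn_adj _ _) |- _ => unfold Dn_adj in H
  end; unfold node, valid, Dn_adj; rewrite ?fixedB /=; lia].

Tactic Notation "rw" uconstr(E) := rewrite E; try nd.

Lemma zF_fixed k s t : node n k -> valid n s t -> fixed k false s t ->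
  S k (zF s t) = r *: zF s t.
Proof.
elim/ltn_ind: t k => t IH k nk v f.
have [e|st1] : t = s.+1 \/ (s.+1 < t)%N by nd.
  by subst t; rewrite zF0; apply: (Wxc rules); nd.
case: t IH v f st1 => // t IH v f st1.
case: (k =P t) => [e|kt]; last first.
  rw zFS. rw (Wcomm rules _ nk). rw (IH t _ k). by rewrite linearZ.
subst k; case: t IH nk v f st1 => // t IH nk v f st1.
rw (@zFS s t.+1). rw (@zFS s t). rw (Wbraid rules). rw (IH t _ t.+2). by rewrite !linearZ.
Qed.

Lemma zF_low s t : valid n s t -> (s.+1 < t)%N -> S s.+1 (zF s t) = zF s.+1 t.
Proof.
elim: t => // t IH v st1; have [e|st2] : t = s.+1 \/ (s.+1 < t)%N by nd.
  by subst t; rewrite zFS // !zF0 (Wxb rules) //; nd.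
rw (@zFS s). rw (@zFS s.+1). rw (Wcomm rules). by rw IH.
Qed.

(** The word of z true s t does not depend on the order in which the two indices
    are raised. *)
Lemma zT_hi s t : valid n s t -> (t < n)%N -> S t.+1 (zT s t) = zT s t.+1.
Proof.
elim: s => // s IH v tn; have [e|s0] : s = 0%N \/ (0 < s)%N by nd.
  by subst s; rewrite zT1S //; nd.
rw (@zTS s t). rw (@zTS s t.+1). rw (Wcomm rules). by rw IH.
Qed.

Lemma zT_fixed k s t : node n k -> valid n s t -> (1 < k)%N -> fixed k true s t ->
  S k (zT s t) = r *: zT s t.
Proof.
elim/ltn_ind: s t k => s IHs; elim/ltn_ind => t IHt k nk v k1 f.
have [e|s1] : s = 1%N \/ (1 < s)%N by nd.
  subst s; have [e|t2] : t = 2%N \/ (2 < t)%N by nd.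
    by subst t; rewrite zT0; apply: (Wxc rules); nd.
  case: t IHt v f t2 => // t IHt v f t2.
  case: (k =P t) => [e|kt]; last first.
    rw zT1S. rw (Wcomm rules _ nk). rw (IHt t _ k). by rewrite linearZ.
  subst k; case: t IHt nk v k1 f t2 => // t IHt nk v k1 f t2.
  rw (@zT1S t.+1). rw (@zT1S t). rw (Wbraid rules). rw (IHt t _ t.+2). by rewrite !linearZ.
case: s IHs IHt v f s1 => // s IHs IHt v f s1.
have [e|st] : (k = s.+2 /\ t = s.+2) \/ [&& s.+2 != k, s.+1 != k, t.+1 != k & t != k] by nd.
  case: e => e1 e2; subst k t.
  rw zTS. rewrite -zT_hi; try nd. rw (Wbraid rules). rw (IHs s _ s.+1 s.+1). by rewrite !linearZ.
case: (k =P s) => [e|ks]; last first.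
  rw zTS. rw (Wcomm rules _ nk). rw (IHs s _ t k). by rewrite linearZ.
subst k; case: s IHs IHt nk k1 v f s1 st => // s IHs IHt nk k1 v f s1 st.
rw (@zTS s.+1). rw (@zTS s). rw (Wbraid rules). rw (IHs s _ t s.+2). by rewrite !linearZ.
Qed.

Lemma P0 i : P i != 0. Proof. exact: pw0. Qed.
Lemma PS i : P i.+1 = r * P i. Proof. exact: pwS. Qed.

(** The scalar by which Epol_(t+1) maps z h s t to xs_(t+1) is obtained by decreasing
    s: S_(s+1) raises s, commutes with Epol_(t+1) and is injective. *)
Lemma Ehi_step s t z1 z2 a b : (0 < s)%N -> (s.+1 < t < n)%N -> z2 = S s.+1 z1 ->
  Epol t.+1 z2 = b *: xs t.+1 -> a = b / r -> Epol t.+1 z1 = a *: xs t.+1.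
Proof.
move=> s0 st -> e ->; apply: (@Winj rules s.+1); first nd.
rewrite -Epol_comm; try nd.
rewrite e linearZ /=; rw (Wxc rules); by rewrite scalerA divfK.
Qed.

(** The four scalars by which Epol_k maps the vectors z to xs_k, for k = s + 1 and
    k = t + 1. *)
Lemma Elo_zF s t : valid n s t -> (s.+1 < t)%N ->
  Epol s.+1 (zF s t) = (m * (P t / P s.+2)) *: xs s.+1.
Proof.
elim: t => // t IH v st; have [e|st1] : t = s.+1 \/ (s.+1 < t)%N by nd.
  by subst t; rewrite zFS // zF0 (WE2 rules) ?mulfV ?mulr1 ?P0 //; nd.
rw (@zFS s t). rw Epol_comm. rw IH. rewrite linearZ /=. rw (Wxc rules).
by rewrite scalerA (PS t); congr (_ *: _); field; rewrite P0.
Qed.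

Lemma Ehi_zF s t : valid n s t -> (t < n)%N ->
  Epol t.+1 (zF s t) = (m / l * (P s.+1 / P t)) *: xs t.+1.
Proof.
elim: {s}(t - s)%N {-2}s (leqnn (t - s)) => [|d IH] s; first nd.
move=> sd v tn; have [e|st1] : t = s.+1 \/ (s.+1 < t)%N by nd.
  by subst t; rewrite zF0 (WE1 rules) ?mulfV ?mulr1 ?P0 //; nd.
apply: (@Ehi_step s t _ (zF s.+1 t) _ (m / l * (P s.+2 / P t))); try nd.
- by rw zF_low.
- by rw IH.
by rewrite (PS s.+1); field; rewrite P0 r0 l0.
Qed.

Lemma Ehi_zT s t : valid n s t -> (t < n)%N ->
  Epol t.+1 (zT s t) = (m / l * (P s.+1 / P t)) *: xs t.+1.
Proof.
elim: t s => [|t IHt] s v tn; first nd.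
have [N] := ubnP (t.+1 - s); elim: N s v => // N IH s v sd.
have [e|st1] : t = s \/ (s < t)%N by nd.
  subst t; rewrite mulfV ?mulr1 ?P0 //.
  case: s v tn sd IHt {IH} => // s v tn sd IHt; case: s v tn sd IHt => [|s] v tn sd IHt.
    by rewrite zT0 (WE1 rules) //; nd.
  rw (@zTS s.+1). rewrite -zT_hi; try nd.
  (* Inserting the eigenvector relation for S_(s+4) makes a braid relation usable. *)
  have e : S s.+4 (zT s.+1 s.+2) = r *: zT s.+1 s.+2 by rw zT_fixed.
  have {e}e : zT s.+1 s.+2 = r^-1 *: S s.+4 (zT s.+1 s.+2) by rewrite e scalerA mulVf // scale1r.
  rw Epol_comm. rewrite e !(linearZ, EpolZ) /=. rw Epol_braid. rw IHt.
  rewrite !linearZ /=. rw (Wxb rules). rw (Wxc rules).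
  by rewrite !scalerA; congr (_ *: _); field; rewrite P0 r0 l0.
apply: (@Ehi_step s t.+1 _ (zT s.+1 t.+1) _ (m / l * (P s.+2 / P t.+1))); try nd.
- by rw zTS.
- by rw IH.
by rewrite (PS s.+1); field; rewrite P0 r0 l0.
Qed.

Lemma Elo_zT s t : valid n s t -> (s.+1 < t)%N ->
  Epol s.+1 (zT s t) = (m / l * (P t / P s.+3)) *: xs s.+1.
Proof.
elim: s t => [|s IHs] t v st; first nd.
elim: t v st => [|t IHt] v st; first nd.
have [e|st1] : t = s.+2 \/ (s.+2 < t)%N by nd.
  subst t; have c : P s.+3 / P s.+4 = r^-1 by rewrite (PS s.+3); field; rewrite r0 P0.
  rewrite c {c IHt}; case: s IHs v st => [|s] IHs v st.
    apply: (@Winj rules 1%N); first nd.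
    rewrite -Epol_comm; try nd. rewrite zT1S // zT0. rw (Wxb rules). rw (WE1 rules).
    rewrite linearZ /=. rw (Wxc rules). by rewrite scalerA divfK.
  rewrite -zT_hi; try nd. rw (@zTS s.+1). rewrite -zT_hi; try nd.
  (* Inserting the eigenvector relation for S_(s+4) makes a braid relation usable. *)
  have e : S s.+4 (zT s.+1 s.+2) = r *: zT s.+1 s.+2 by rw zT_fixed.
  have {e}e : zT s.+1 s.+2 = r^-1 *: S s.+4 (zT s.+1 s.+2) by rewrite e scalerA mulVf // scale1r.
  rewrite e !(linearZ, EpolZ) /=. rw (@Wcomm rules s.+4 s.+2).
  rw (@Wbraid rules s.+4 s.+3).
  rw Epol_braid. rw (@Epol_comm s.+4). rw zT_hi. rw IHs.
  rewrite !linearZ /=. rw (Wxc rules). rewrite !linearZ /=. rw (Wxb rules).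
  by rewrite !scalerA (PS s.+3); congr (_ *: _); field; rewrite P0 r0 l0.
rewrite -zT_hi; try nd. rw (@Epol_comm t.+1). rw IHt.
rewrite linearZ /=. rw (Wxc rules).
by rewrite scalerA (PS t); congr (_ *: _); field; rewrite P0 l0.
Qed.

Lemma E1_zT1 t : (2 < t <= n)%N -> Epol 1 (zT 1 t) = (m * (P t / P 3)) *: xs 1.
Proof.
elim: t => // t IH tn; have [e|t2] : t = 2%N \/ (2 < t)%N by nd.
  by subst t; rewrite zT1S // zT0 (WE2 rules) ?mulfV ?mulr1 ?P0 //; nd.
rw (@zT1S t). rw Epol_comm. rw IH. rewrite linearZ /=. rw (Wxc rules).
by rewrite scalerA (PS t); congr (_ *: _); field; rewrite P0.
Qed.

Lemma E1_zT2 t : (2 < t <= n)%N -> Epol 1 (zT 2 t) = (m * (P t / P 2)) *: xs 1.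
Proof.
move=> tn; rw (@zTS 1%N). rw Epol_comm. rw E1_zT1. rewrite linearZ /=. rw (Wxc rules).
by rewrite scalerA (PS 2); congr (_ *: _); field; rewrite P0 r0.
Qed.

Lemma S1_zT1 t : (2 < t <= n)%N -> S 1 (zT 1 t) = zF 2 t.
Proof.
elim: t => // t IH tn; have [e|t2] : t = 2%N \/ (2 < t)%N by nd.
  by subst t; rewrite zT1S // zT0 zF0; rw (Wxb rules).
rw (@zT1S t). rw (@zFS 2 t). rw (Wcomm rules). by rw IH.
Qed.

Lemma S1_zT2 t : (2 < t <= n)%N ->
  S 1 (zT 2 t) = zF 1 t + (m * (P t / P 3)) *: xs 2 - m *: zF 2 t.
Proof.
move=> tn; rw (@zTS 1%N). rw (Wcomm rules). rw S1_zT1.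
rewrite -zF_low; try nd. rewrite SS. rw Elo_zF. lmod.
Qed.

Lemma S1_zF2 t : (2 < t <= n)%N ->
  S 1 (zF 2 t) = zT 1 t + (m * (P t / P 3)) *: xs 1 - m *: zF 2 t.
Proof.
move=> tn; rewrite -S1_zT1 // SS. rw E1_zT1. lmod.
Qed.

Lemma S1_zF1 t : (2 < t <= n)%N ->
  S 1 (zF 1 t) = zT 2 t + (m * (P t / P 4)) *: (xs 1 - xs 2) + m *: (zT 1 t - zF 1 t).
Proof.
move=> tn; have e : zF 1 t = S 1 (zT 2 t) - (m * (P t / P 3)) *: xs 2 + m *: zF 2 t.
  rw S1_zT2. lmod.
rewrite {1}e linearD linearB !linearZ /= SS. rw E1_zT2. rw (Wxc rules). rw S1_zF2.
rw S1_zT2. rewrite (PS 3) (PS 2) /m; lmodf. by rewrite P0 r0.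
Qed.

Lemma S1_zF_fixed s t : valid n s t -> (2 < s)%N -> S 1 (zF s t) = r *: zF s t.
Proof. by move=> v s2; rw zF_fixed. Qed.

Definition zd s t := zT s t - zF s t.

(** The right-hand side of the formula for nu_1 \hat w_(i,j), 3 <= i < j. *)
Definition S1_img i j : W :=
  (m * (P j / P 5)) *: zd 1 i + (m * (P j / P 4)) *: zd 2 i
  + (m * (P i / P 3)) *: zd 1 j + (m * (P i / P 2)) *: zd 2 j
  + (m ^+ 2 * (P i * P j / P 8 + P i * P j / P 6)) *: zd 1 2 + r *: zT i j.

(** The formulas of nu_k, in terms of the vectors z. *)
Lemma SS_hi h s t : valid n s t -> (t < n)%N -> S t.+1 (z h s t.+1) =
  z h s t + (m / l * (P s.+1 / P t)) *: xs t.+1 - m *: z h s t.+1.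
Proof.
by case: h => v tn; rewrite /z; [rewrite -zT_hi //; rewrite SS Ehi_zT //|
  rewrite zFS; [rewrite SS Ehi_zF //|nd]]; lmod.
Qed.

Lemma SS_loF s t : valid n s t -> (s.+1 < t)%N -> S s.+1 (zF s.+1 t) =
  zF s t + (m * (P t / P s.+2)) *: xs s.+1 - m *: zF s.+1 t.
Proof. move=> v st; rewrite -zF_low // SS Elo_zF //; lmod. Qed.

Lemma SS_loT s t : valid n s t -> (s.+1 < t)%N -> S s.+1 (zT s.+1 t) =
  zT s t + (m / l * (P t / P s.+3)) *: xs s.+1 - m *: zT s.+1 t.
Proof. move=> v st; rw zTS. rewrite SS Elo_zT //; lmod. Qed.

(** Since S_3 is injective and zT 3 j = S_3 (zT 2 j), the braid relation of nodes 1
    and 3 reduces the formula to those for indices 1 and 2. *)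
Lemma S1_zT3 j : (3 < j <= n)%N -> S 1 (zT 3 j) = S1_img 3 j.
Proof.
move=> jn; apply: (@Winj rules 3%N); first nd.
rw (@zTS 2%N). rw (Wbraid rules). rw S1_zT2. rewrite !(linearD, linearN, linearZ) /=.
have c1 : S 3 (zF 1 j) = r *: zF 1 j by rw zF_fixed.
have c2 : S 3 (xs 2) = zF 1 3 by rewrite -(zF0 1) -zFS.
have c3 : S 3 (zF 2 j) = zF 3 j by rw zF_low.
rewrite c1 c2 c3 !linearZ /=. rw (S1_zF1 (t := j)). rw (S1_zF1 (t := 3%N)).
rw S1_zF_fixed.
have a1 : S 3 (zT 1 2) = zT 1 3 by rewrite -zT1S.
have a2 : S 3 (zF 1 2) = zF 1 3 by rewrite -zFS.
have a3 : S 3 (zT 1 3) = zT 1 2 + (m / l * (P 2 / P 2)) *: xs 3 - m *: zT 1 3.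
  by rewrite (SS_hi true (s := 1%N) (t := 2%N)) //; nd.
have a4 : S 3 (zF 1 3) = zF 1 2 + (m / l * (P 2 / P 2)) *: xs 3 - m *: zF 1 3.
  by rewrite (SS_hi false (s := 1%N) (t := 2%N)) //; nd.
have a5 : S 3 (zT 2 3) = r *: zT 2 3 by rw zT_fixed.
have a6 : S 3 (zF 2 3) = l^-1 *: xs 3 by rewrite zF0; rw (Wxx rules).
have a7 : S 3 (zT 1 j) = r *: zT 1 j by rw zT_fixed.
have a8 : S 3 (zF 1 j) = r *: zF 1 j by rw zF_fixed.
have a9 : S 3 (zT 2 j) = zT 3 j by rewrite -zTS.
have a10 : S 3 (zF 2 j) = zF 3 j by rw zF_low.
have a11 : S 3 (zT 3 j) = zT 2 j + (m / l * (P j / P 5)) *: xs 3 - m *: zT 3 j.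
  by rw SS_loT.
rewrite /S1_img /zd !(linearD, linearN, linearZ) /=.
rewrite !(a1, a2, a3, a4, a5, a6, a7, a8, a9, a10, a11) -[xs 1]zT0 -[xs 2]zF0 -[xs 3]zF0.
have pE : P 2 = r ^+ 2 /\ P 3 = r ^+ 3 /\ P 4 = r ^+ 4 /\ P 5 = r ^+ 5 /\
  P 6 = r ^+ 6 /\ P 8 = r ^+ 8 by [].
case: pE => -> [-> [-> [-> [-> ->]]]].
rewrite /m; lmodf.
by rewrite r0 l0.
Qed.

(** The words of z true i j and of z true (i+1) j differ by S_(i+1), which commutes
    with S_1 when i >= 3. *)
Lemma S1_zT i j : (2 < i)%N -> valid n i j -> S 1 (zT i j) = S1_img i j.
Proof.
elim: i => // i IH i2 v; have [e|i3] : i = 2%N \/ (2 < i)%N by nd.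
  by subst i; rw S1_zT3.
rw (@zTS i). rw (Wcomm rules). rw IH.
rewrite /S1_img /zd !(linearD, linearN, linearZ) /=.
have b1 : S i.+1 (zT 1 i) = zT 1 i.+1 by rw zT_hi.
have b2 : S i.+1 (zT 2 i) = zT 2 i.+1 by rw zT_hi.
have b3 : S i.+1 (zF 1 i) = zF 1 i.+1 by rw zFS.
have b4 : S i.+1 (zF 2 i) = zF 2 i.+1 by rw zFS.
have b5 : S i.+1 (zT 1 j) = r *: zT 1 j by rw zT_fixed.
have b6 : S i.+1 (zT 2 j) = r *: zT 2 j by rw zT_fixed.
have b7 : S i.+1 (zF 1 j) = r *: zF 1 j by rw zF_fixed.
have b8 : S i.+1 (zF 2 j) = r *: zF 2 j by rw zF_fixed.
have b9 : S i.+1 (zT 1 2) = r *: zT 1 2 by rw zT_fixed.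
have b10 : S i.+1 (zF 1 2) = r *: zF 1 2 by rw zF_fixed.
have b11 : S i.+1 (zT i j) = zT i.+1 j by rewrite -zTS //; nd.
rewrite !(b1, b2, b3, b4, b5, b6, b7, b8, b9, b10, b11) !(PS i).
have pE : P 2 = r ^+ 2 /\ P 3 = r ^+ 3 /\ P 4 = r ^+ 4 /\ P 5 = r ^+ 5 /\
  P 6 = r ^+ 6 /\ P 8 = r ^+ 8 by [].
case: pE => -> [-> [-> [-> [-> ->]]]].
lmodf; by rewrite r0.
Qed.

End Words.

(** * The intertwiner on the basis of V_n *)

Section Intertwine.
Variables (F : fieldType) (n : nat) (l r : F).
Hypothesis r0 : r != 0.
Hypothesis l0 : l != 0.
Let m : F := r^-1 - r.
Notation W := (Dn_space F n).
Variables (S : nat -> 'End(W)) (xs : nat -> W).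
Hypothesis rules : words_rules l r S xs.

Notation P := (pw r).
Notation x := (w F n).
Notation z := (z S xs).

Lemma expz_sub (a b : nat) (e : int) : e = a%:Z - b%:Z -> r ^ e = P a / P b.
Proof. by move=> ->; rewrite expfzDr // -exprnP -exprnN. Qed.

(** The intertwiner: it maps the basis vector w h s t to z h s t. *)
Definition zmap : 'End(W) := linext (fun b => z (flag b) (lo b) (hi b)).

Lemma zmap_w h s t : valid n s t -> zmap (x h s t) = z h s t.
Proof. exact: (@linext_w n F (fun h s t => z h s t)). Qed.

Lemma intertwine_1 h i j : valid n i j ->
  zmap (nu1_img n l r h i j) = S 1 (z h i j).
Proof.
move=> v; have [i0 ij jn] := and3P v; rewrite /nu1_img.
have two : (2%:R : nat) = 2%N by [].
have PD a b : P (a + b) = P a * P b by exact: exprD.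
case: ifP => [/andP[ht i2]|c1].
  rewrite ht /z (S1_zT r0 l0 rules i2 v) /S1_img /zd !two.
  rewrite !(linearD, linearN, linearZ) /= !zmap_w; try by rewrite /valid; lia.
  rewrite (@expz_sub j 5) // (@expz_sub j 4) // (@expz_sub i 3) // (@expz_sub i 2) //.
  rewrite (@expz_sub (i + j) 8) ?(@expz_sub (i + j) 6) ?PD; [|lia..].
  rewrite /z; lmod.
case: ifP => [/and3P[ht /eqP ei j2]|c2].
  subst i; rewrite ht zmap_w; last by rewrite /valid; lia.
  by rewrite /z (S1_zT1 r0 l0 rules) //; lia.
case: ifP => [/and3P[ht /eqP ei j2]|c3].
  subst i; rewrite ht /z (S1_zT2 r0 l0 rules); last lia.
  rewrite !(linearD, linearN, linearZ) /= !zmap_w; try by rewrite /valid; lia.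
  by rewrite (@expz_sub j 3) // /z zF0.
case: ifP => [/and3P[ht /eqP ei j2]|c4].
  subst i; rewrite (negPf ht) /z (S1_zF2 r0 l0 rules); last lia.
  rewrite !(linearD, linearN, linearZ) /= !zmap_w; try by rewrite /valid; lia.
  by rewrite (@expz_sub j 3).
case: ifP => [/and3P[ht /eqP ei j2]|c5].
  subst i; rewrite (negPf ht) /z (S1_zF1 r0 l0 rules) ?two; last lia.
  rewrite !(linearD, linearN, linearZ) /= !zmap_w; try by rewrite /valid; lia.
  rewrite (@expz_sub j 4) // -(zT0 S xs) -(zF0 S xs 1) /z; lmod.
have n1 : node n 1 by rewrite /node; lia.
case: ifP => [/and3P[ht /eqP ei /eqP ej]|c6].
  subst i j; rewrite ht linearZ /= zmap_w // /z zT0 (Wxx rules) //.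
rewrite linearZ /= zmap_w //; move: c1 c2 c3 c4 c5 c6; rewrite /z.
case: h => /= c1 c2 c3 c4 c5 c6; last first.
  by rewrite (zF_fixed r0 l0 rules) // /fixed /=; lia.
exfalso; lia.
Qed.

Lemma intertwine_k k h s t : node n k -> (1 < k)%N -> valid n s t ->
  zmap (nuk_img n l r k h s t) = S k (z h s t).
Proof.
move=> nk k1 v; have [s0 st tn] := and3P v; have /andP[k0 kn] := nk; rewrite /nuk_img.
case: k nk k1 k0 kn => // k nk k1 k0 kn; rewrite !succnK.
case: ifP => [/andP[/eqP es kt]|c1].
  subst s; rewrite zmap_w; last by rewrite /valid; lia.
  by case: h; rewrite /z ?zTS // (zF_low r0 l0 rules) //; rewrite /valid; lia.
case: ifP => [/andP[/eqP et sk]|c2].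
  subst t; rewrite zmap_w; last by rewrite /valid; lia.
  by case: h; rewrite /z ?zFS // (zT_hi r0 l0 rules) //; rewrite /valid; lia.
case: ifP => [/andP[/eqP es /eqP et]|c3].
  subst s t; rewrite linearZ /= zmap_w //; case: h; rewrite /z.
    by rewrite (zT_fixed r0 l0 rules) // /fixed; case: (k.+1 =P 1%N); rewrite ?eqxx ?orbT //; lia.
  by rewrite zF0 (Wxx rules).
case: ifP => [/andP[/eqP es kt]|c4].
  subst s; case: h; rewrite !(linearD, linearN, linearZ) /= !zmap_w;
    try by rewrite /valid; lia.
    rewrite (@expz_sub t k.+3); last lia.
    rewrite /z (SS_loT r0 l0 rules) ?zF0; try by rewrite /valid; lia.
    lmod.
  rewrite (@expz_sub t k.+2); last lia.
  rewrite /z (SS_loF r0 l0 rules) ?zF0; try by rewrite /valid; lia.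
  lmod.
case: ifP => [/andP[/eqP et sk]|c5].
  subst t; rewrite !(linearD, linearN, linearZ) /= !zmap_w;
    try by rewrite /valid; lia.
  rewrite (SS_hi r0 l0 rules) ?zF0; try by rewrite /valid; lia.
  rewrite (@expz_sub k s.+1); last lia.
  have -> : m / (l * (P k / P s.+1)) = m / l * (P s.+1 / P k).
    by field; rewrite l0 !pw0.
  by case: (h); rewrite /z zF0 /m; lmod.
rewrite linearZ /= zmap_w //; rewrite /z; case: h.
  by rewrite (zT_fixed r0 l0 rules) // fixedB; lia.
by rewrite (zF_fixed r0 l0 rules) // fixedB; lia.
Qed.

End Intertwine.

(** * The rescaled Cohen-Wales generators *)

Lemma Dn_adj_neq i j : Dn_adj i j -> i != j.
Proof. by rewrite /Dn_adj; lia. Qed.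

Section Assemble.
Variables (F : fieldType) (n : nat) (l r t : F).
Hypothesis n2 : (1 < n)%N.
Hypothesis r0 : r != 0.
Hypothesis l0 : l != 0.
Hypothesis tE : t = r ^+ 3 / l.
Let m : F := r^-1 - r.
Notation rho := r^-1.
Notation W := (Dn_space F n).
Notation x := (w F n).
Notation xa := (xa F n).
Variables (tau : nat -> 'End(W)) (f : nat -> {scalar W}) (Sr : nat -> 'End(W)).
Hypothesis rules : tau_rules rho tau.
Hypothesis Trules : T_rules rho tau f.
Hypothesis SrE : forall k v, Sr k v = r *: sigma t tau f k v.

Let rho0 : rho != 0. Proof. by rewrite invr_eq0. Qed.

Lemma Sr_xa k : node n k -> Sr k (xa k) = l^-1 *: xa k.
Proof.
move=> nk; rewrite SrE /sigma (tau_xa n2 rules nk) (T_diag Trules nk) tE.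
by lmodf; rewrite r0 l0.
Qed.

Lemma Sr_xa_nadj i j : node n i -> node n j -> i != j -> ~~ Dn_adj i j ->
  Sr i (xa j) = r *: xa j.
Proof.
move=> ni nj ij nadj; rewrite SrE /sigma (tau_xa_comm n2 rules ni nj) //.
by rewrite (T_simple Trules) // mulr0 scale0r addr0.
Qed.

(** S_k^2 + m S_k - 1 has rank at most one. *)
Lemma Sr_line k v : node n k -> exists c, Epol r Sr k v = c *: xa k.
Proof.
move=> nk; rewrite [v]w_sum; elim/big_ind: _ => [|u u' [c e] [c' e']|b _].
- by exists 0; rewrite /Epol !linear0 scale0r ?scaler0 ?subr0 ?addr0.
- exists (c + c'); rewrite scalerDl -e -e' /Epol !linearD /=.
  by rewrite [RHS]addrACA [X in _ = X + _]addrACA.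
rewrite EpolZ; set h := flag b; set s := lo b; set s' := hi b.
have v0 : valid n s s' by exact: idx_valid.
suff [c ->] : exists c, Epol r Sr k (x h s s') = c *: xa k.
  by exists (v b * c); rewrite scalerA.
case sm : (simple k h s s').
  rewrite -(xa_simple F n2 nk v0 sm) /Epol Sr_xa // linearZ /= Sr_xa //.
  exists (l^-1 * l^-1 + m * l^-1 - 1); rewrite /m; lmod.
(* Away from alpha_k the quadratic relation of tau_k kills the terms outside the
   line of x_(alpha_k). *)
have q := tau_quad n2 rules nk v0 (negbT sm).
exists (r * t * (r * f k (tau k (x h s s')) + r * (t * f k (x h s s')) * rho ^+ 4)
   + m * (r * (t * f k (x h s s')))).
rewrite /Epol !SrE /sigma !linearZ /= !linearD /= !linearZ /= q (tau_xa n2 rules nk).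
by rewrite (T_diag Trules nk) tE /m; lmodf; rewrite r0 l0.
Qed.

Lemma Sr_inj k u v : node n k -> Sr k u = Sr k v -> u = v.
Proof.
move=> nk /eqP; rewrite -subr_eq0 -linearB => /eqP e.
apply/eqP; rewrite -subr_eq0; set d := u - v in e *.
have [c ec] := Sr_line d nk.
have ed : d = - c *: xa k.
  by rewrite scaleNr -ec /Epol e !linear0 ?scaler0 ?add0r ?sub0r opprK.
have : l^-1 *: d = 0 by rewrite -e {2}ed !linearZ /= Sr_xa // ed; lmod.
by move/eqP; rewrite scaler_eq0 invr_eq0 (negPf l0).
Qed.

(** The action on y = x_(alpha_i + alpha_j), for adjacent i and j. *)
Lemma Sr_sum i j : node n i -> node n j -> Dn_adj i j ->
  exists y, [/\ Sr i (xa j) = y - m *: xa j, Sr j (xa i) = y - m *: xa i &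
    Sr i y = xa j + (m / l) *: xa i].
Proof.
move=> ni nj adj; have ij := Dn_adj_neq adj.
have [y [e1 e2 e3 e4 _]] := sum_vec n2 rules ni nj ij adj.
have ji : j != i by rewrite eq_sym.
have fi := f_sum n2 rho0 rules Trules ni nj ij adj e2.
exists y; split; rewrite SrE /sigma.
- rewrite e1 (T_simple Trules ni nj ij) /m; lmodf; by rewrite r0.
- rewrite e2 (T_simple Trules nj ni ji) /m; lmodf; by rewrite r0.
- rewrite e3 fi tE /m; lmodf; by rewrite r0 l0.
Qed.

Lemma Sr_words : words_rules l r Sr xa.
Proof.
split; [| |exact: Sr_inj|exact: Sr_xa|exact: Sr_xa_nadj| | |].
- move=> i j v ni nj ij nadj; rewrite !SrE !sigmaZ.
  by rewrite (sigma_comm n2 t rules Trules v ni nj ij nadj).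
- move=> i j v ni nj adj; rewrite !SrE !sigmaZ.
  by rewrite (sigma_braid n2 t rho0 rules Trules v ni nj (Dn_adj_neq adj) adj).
all: move=> i j ni nj adj; have [y [e1 e2 e3]] := Sr_sum ni nj adj.
- rewrite e2 linearB linearZ /= e3 Sr_xa // /m; lmodf; by rewrite l0 r0.
- rewrite /Epol e1 linearB linearZ /= e1 e3 /m; lmodf; by rewrite l0 r0.
- rewrite e2 /Epol !(linearB, linearD, linearZ) /= e3 Sr_xa //.
  rewrite !(linearB, linearD, linearZ) /= e1 Sr_xa // /m; lmodf; by rewrite l0 r0.
Qed.

End Assemble.

(** * Bijectivity of the intertwiner *)

Section Transport.
Variables (F : fieldType) (n : nat) (l r t : F).
Hypothesis n2 : (1 < n)%N.
Hypothesis r0 : r != 0.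
Hypothesis l0 : l != 0.
Hypothesis tE : t = r ^+ 3 / l.
Let m : F := r^-1 - r.
Notation rho := r^-1.
Notation W := (Dn_space F n).
Notation x := (w F n).
Notation xa := (xa F n).
Variables (tau : nat -> 'End(W)) (f : nat -> {scalar W}) (Sr : nat -> 'End(W)).
Hypothesis rules : tau_rules rho tau.
Hypothesis Trules : T_rules rho tau f.
Hypothesis SrE : forall k v, Sr k v = r *: sigma t tau f k v.

Notation phi := (zmap Sr xa).
Notation N k := (nu n l r k : 'End(W)).

Let words : words_rules l r Sr xa.
Proof. exact: (Sr_words n2 r0 l0 tE rules Trules SrE). Qed.

Lemma nu_w k h i j : valid n i j ->
  N k (x h i j) = if k == 1%N then nu1_img n l r h i j else nuk_img n l r k h i j.
Proof.
exact: (@linext_w n F (fun h i j =>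
  if k == 1%N then nu1_img n l r h i j else nuk_img n l r k h i j)).
Qed.

Lemma phi_nu k v : node n k -> phi (N k v) = Sr k (phi v).
Proof.
move=> nk; move: v; apply: w_ext; [by move=> a u v; rewrite !linearP..|] => h i j v.
rewrite nu_w // zmap_w //; case: (k =P 1%N) => [->|k1].
  exact: (intertwine_1 r0 l0 words).
by apply: (intertwine_k r0 l0 words) => //; move: nk; rewrite /node; lia.
Qed.

Lemma phi_xa k : node n k -> exists u, phi u = xa k.
Proof.
move=> nk; case: (k =P 1%N) => [->|k1].
  by exists (x true 1 2); rewrite zmap_w.
exists (x false k.-1 k); rewrite zmap_w; last by move: nk; rewrite /node /valid; lia.
have {2 3}-> : k = k.-1.+1 by move: nk; rewrite /node; lia.
by rewrite /z zF0.
Qed.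

Lemma phi_surj v : exists u, phi u = v.
Proof.
suff B h i j : valid n i j -> exists u, phi u = x h i j.
  rewrite [v]w_sum; elim/big_ind: _ => [|a b [u <-] [u' <-]|b _].
  - by exists 0; rewrite linear0.
  - by exists (u + u'); rewrite linearD.
  have [u e] := B (flag b) (lo b) (hi b) (idx_valid b).
  by exists (v b *: u); rewrite linearZ /= e.
have [M] := ubnP (ht h i j); elim: M h i j => // M IH h i j; rewrite ltnS => hM v0.
have smp k : node n k -> simple k h i j -> exists u, phi u = x h i j.
  by move=> nk sk; rewrite -(xa_simple F n2 nk v0 sk); apply: phi_xa.
have nj : node n j by move: v0; rewrite /node /valid; lia.
case s1 : (simple j h i j); first exact: smp s1.
case s2 : (simple 1 h i j); first by apply: smp s2; rewrite /node; lia.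
have [k [h' [i' [j' st]]]] : exists k h' i' j', step n k h i j h' i' j'.
  case: (descent n2 nj v0 (negbT s1) (negbT s2)).
    by move=> [k [h' [i' [j' [_ st]]]]]; exists k, h', i', j'.
  by move=> [k [h' [i' [j' [_ _ _ _ st]]]]]; exists j, h', i', j'.
have [nk _ v'] := step_valid n2 st.
have [u eu] := IH h' i' j' (leq_trans (step_ht n2 st) hM) v'.
have [u' eu'] := phi_xa nk.
exists (N k u - (r * (1 - rho ^+ 2)) *: u - (r * t * f k (x h' i' j')) *: u').
rewrite !linearB !linearZ /= phi_nu // eu eu' SrE /sigma (ruleU rules st).
lmodf; by rewrite r0.
Qed.

Lemma phi_invK : cancel phi (phi^-1)%VF /\ cancel (phi^-1)%VF phi.
Proof.
have full : limg phi = fullv.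
  apply/vspaceP => v; rewrite memvf; have [u <-] := phi_surj v.
  by rewrite memv_img ?memvf.
have ker0 : lker phi == 0%VS.
  rewrite -dimv_eq0; have := limg_ker_dim phi fullv.
  by rewrite capfv full => /eqP; rewrite -[X in _ == X]add0n eqn_add2r.
split=> v; first by rewrite lker0_lfunK.
by apply: limg_lfunVK; rewrite full memvf.
Qed.

End Transport.

(** * Endomorphism rings and groups of units *)

Section EndoRing.
Variables (F : fieldType) (V : vectType F).
Implicit Types (A B : endo V) (v : V).

(** Evaluation of an element of the ring of endomorphisms. *)
Definition ev A v : V := (A : 'End(V)) v.

Lemma ev_ext A B : ev A =1 ev B -> A = B.
Proof. by move=> AB; apply/lfunP. Qed.
Lemma evM A B v : ev (A * B) v = ev A (ev B v).
Proof. exact: comp_lfunE. Qed.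
Lemma ev1 v : ev 1 v = v.
Proof. exact: id_lfunE. Qed.
Lemma evD A B v : ev (A + B) v = ev A v + ev B v.
Proof. exact: add_lfunE. Qed.
Lemma evN A v : ev (- A) v = - ev A v.
Proof. exact: opp_lfunE. Qed.
Lemma evZ c A v : ev (c *: A) v = c *: ev A v.
Proof. exact: scale_lfunE. Qed.
Lemma evX2 A v : ev (A ^+ 2) v = ev A (ev A v).
Proof. by rewrite expr2 evM. Qed.
Lemma ev_linZ A c v : ev A (c *: v) = c *: ev A v.
Proof. exact: linearZ. Qed.

Lemma ev_braid A B v : A * B * A = B * A * B ->
  ev A (ev B (ev A v)) = ev B (ev A (ev B v)).
Proof. by move=> e; rewrite -!evM e. Qed.
Lemma ev_comm A B v : A * B = B * A -> ev A (ev B v) = ev B (ev A v).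
Proof. by move=> e; rewrite -!evM e. Qed.

Lemma braid_ev A B : (forall v, ev A (ev B (ev A v)) = ev B (ev A (ev B v))) ->
  A * B * A = B * A * B.
Proof. by move=> e; apply: ev_ext => v; rewrite !evM. Qed.
Lemma comm_ev A B : (forall v, ev A (ev B v) = ev B (ev A v)) -> A * B = B * A.
Proof. by move=> e; apply: ev_ext => v; rewrite !evM. Qed.

Lemma artin_rel_ev n (s : 'I_n -> endo V) (g : nat -> V -> V) :
  (forall i v, ev (s i) v = g i.+1 v) ->
  (forall (i j : 'I_n) v, Dn_adj i.+1 j.+1 ->
    g i.+1 (g j.+1 (g i.+1 v)) = g j.+1 (g i.+1 (g j.+1 v))) ->
  (forall (i j : 'I_n) v, i != j -> ~~ Dn_adj i.+1 j.+1 ->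
    g i.+1 (g j.+1 v) = g j.+1 (g i.+1 v)) ->
  artin_rel *%R s.
Proof.
move=> sE Hb Hc; split=> [i j adj|i j ij nadj].
  by apply: braid_ev => v; rewrite !sE Hb.
by apply: comm_ev => v; rewrite !sE Hc.
Qed.

(** The structure map of the algebra of endomorphisms. *)
Definition escal (c : F) : endo V := c *: (1 : endo V).

Lemma ev_scal c A v : ev (escal c * A) v = c *: ev A v.
Proof. by rewrite evM /escal evZ ev1. Qed.

Fact escal_is_zmod : zmod_morphism escal.
Proof. by move=> a b; apply: scalerBl. Qed.
Fact escal_is_monoid : monoid_morphism escal.
Proof.
split=> [|a b]; first exact: scale1r.
by apply: ev_ext => v; rewrite evM /escal !evZ !ev1 scalerA.
Qed.
HB.instance Definition _ := GRing.isZmodMorphism.Build F (endo V) escal escal_is_zmod.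
HB.instance Definition _ := GRing.isMonoidMorphism.Build F (endo V) escal escal_is_monoid.

End EndoRing.

Section UnitGroup.
Variable A : pzRingType.

(** Two mutually inverse elements; these pairs form the group of units of A, an
    invertible element being recorded with its inverse. *)
Definition inverse_pair (p : A * A) : bool := (p.1 * p.2 == 1) && (p.2 * p.1 == 1).
Definition inv_pair : Type := {p : A * A | inverse_pair p}.
HB.instance Definition _ := Choice.on inv_pair.

Lemma inv_pairP (p : inv_pair) : (val p).1 * (val p).2 = 1 /\ (val p).2 * (val p).1 = 1.
Proof. by case: p => p /= /andP[/eqP-> /eqP->]. Qed.

Lemma inv_pair_eq (p q : inv_pair) : (val p).1 = (val q).1 -> p = q.
Proof.
move=> e; apply: val_inj; have [p1 p2] := inv_pairP p; have [q1 q2] := inv_pairP q.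
case: (val p) (val q) e p1 p2 q1 q2 => [a b] [a' b'] /= <- p1 p2 q1 q2.
by congr (_, _); rewrite -[b]mulr1 -q1 mulrA p2 mul1r.
Qed.

Fact pair_mul_proof (p q : inv_pair) :
  inverse_pair ((val p).1 * (val q).1, (val q).2 * (val p).2).
Proof.
have [p1 p2] := inv_pairP p; have [q1 q2] := inv_pairP q; rewrite /inverse_pair /=.
rewrite mulrA -[_ * _ * (val q).2]mulrA q1 mulr1 p1 eqxx /=.
by rewrite mulrA -[_ * _ * (val p).1]mulrA p2 mulr1 q2 eqxx.
Qed.
Definition pair_mul p q : inv_pair := @exist (A * A) (fun u => inverse_pair u) _ (pair_mul_proof p q).
Fact pair_one_proof : inverse_pair (1, 1).
Proof. by rewrite /inverse_pair /= mulr1 eqxx. Qed.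
Definition pair_one : inv_pair := @exist (A * A) (fun u => inverse_pair u) _ pair_one_proof.
Fact pair_inv_proof (p : inv_pair) : inverse_pair ((val p).2, (val p).1).
Proof. by have [p1 p2] := inv_pairP p; rewrite /inverse_pair /= p1 p2 eqxx. Qed.
Definition pair_inv p : inv_pair := @exist (A * A) (fun u => inverse_pair u) _ (pair_inv_proof p).

Fact pair_mulA : associative pair_mul.
Proof. by move=> p q u; apply: inv_pair_eq; rewrite /= mulrA. Qed.
Fact pair_mul1 : left_id pair_one pair_mul.
Proof. by move=> p; apply: inv_pair_eq; rewrite /= mul1r. Qed.
Fact pair_mulr1 : right_id pair_one pair_mul.
Proof. by move=> p; apply: inv_pair_eq; rewrite /= mulr1. Qed.
Fact pair_mulV : left_inverse pair_one pair_inv pair_mul.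
Proof. by move=> p; apply: inv_pair_eq; have [_ /= ->] := inv_pairP p. Qed.
Fact pair_mulrV : right_inverse pair_one pair_inv pair_mul.
Proof. by move=> p; apply: inv_pair_eq; have [/= -> _] := inv_pairP p. Qed.

HB.instance Definition _ := isGroup.Build inv_pair
  pair_mulA pair_mul1 pair_mulr1 pair_mulV pair_mulrV.

End UnitGroup.

(** Invertible endomorphisms that satisfy the Artin relations define a
    representation of the Artin group. *)
Lemma artin_rep_lift (F : fieldType) (V : vectType F) (n : nat) (s s' : 'I_n -> endo V) :
  artin_rel *%R s -> (forall i, s i * s' i = 1) -> (forall i, s' i * s i = 1) ->
  exists R : artin n -> endo V, group_rep R /\ forall i, R (artin_gen i) = s i.
Proof.
move=> [Hb Hc] ss' s's.
have pf i : inverse_pair (s i, s' i).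
  by rewrite /inverse_pair /= ss' s's eqxx.
pose g i : inv_pair (endo V) := @exist _ (fun u => inverse_pair u) _ (pf i).
have [|h [hM hg]] := @artin_lift n (inv_pair (endo V)) g.
  by split=> i j; [move/Hb|move=> ij /(Hc i j ij)] => e; apply: inv_pair_eq.
exists (fun a => (val (h a)).1); split; last by move=> i; rewrite hg.
split=> [|a b]; last by rewrite hM.
have : h 1%g = 1%g by apply: (mulgI (h 1%g)); rewrite -hM !mulg1.
by move=> ->.
Qed.

(** * The relations of the CGW algebra *)

Section Relations.
Variables (F : fieldType) (n : nat) (l r : F).
Hypothesis r0 : r != 0.
Hypothesis l0 : l != 0.
Let m : F := r^-1 - r.
Hypothesis m0 : m != 0.
Notation W := (Dn_space F n).
Variables (S : nat -> 'End(W)) (xs : nat -> W) (phi : 'End(W)) (N : nat -> endo W).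
Hypothesis words : words_rules l r S xs.
Hypothesis line : forall k v, node n k -> exists c, Epol r S k v = c *: xs k.
Hypothesis phi_inj : injective phi.
Hypothesis phi_nu : forall k v, node n k -> phi (ev (N k) v) = S k (phi v).

Lemma nu_artin : artin_rel *%R (fun i : 'I_n => N i.+1).
Proof.
split=> i j.
  move=> adj; apply: ev_ext => v; apply: phi_inj; rewrite !evM !phi_nu ?node_ord //.
  by rewrite (Wbraid words) // node_ord.
move=> ij nadj; apply: ev_ext => v; apply: phi_inj; rewrite !evM !phi_nu ?node_ord //.
by rewrite (Wcomm words) ?node_ord // eqSS.
Qed.

(** The image of the generator e_i, as imposed by the relation that defines it. *)
Definition nu_e (i : 'I_n) : endo W :=
  (l / m) *: (N i.+1 ^+ 2 + m *: N i.+1 - 1).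

Lemma phi_nu_e i v : phi (ev (nu_e i) v) = (l / m) *: Epol r S i.+1 (phi v).
Proof.
rewrite /nu_e evZ !(evD, evN, evZ, evX2, ev1) linearZ /= !(linearD, linearN, linearZ) /=.
by rewrite !phi_nu ?node_ord.
Qed.

Lemma nu_cgw : cgw_rel l m (@escal F W) (fun i : 'I_n => N i.+1) nu_e.
Proof.
split.
- move=> c A; apply: ev_ext => v; rewrite ev_scal evM /escal evZ ev1.
  by rewrite ev_linZ.
- exact: nu_artin.
- move=> i; apply: ev_ext => v; rewrite !ev_scal /nu_e evZ scalerA.
  have -> : m * (l / m) = l by field.
  by rewrite !(evD, evN, evZ, ev_scal).
- move=> i; apply: ev_ext => v; apply: phi_inj; rewrite evM phi_nu ?node_ord //.
  rewrite ev_scal linearZ /= !phi_nu_e; have [c ->] := line (phi v) (node_ord i).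
  rewrite !linearZ /= (Wxx words) ?node_ord //; lmod.
move=> i j adj; apply: ev_ext => v; apply: phi_inj; rewrite ev_scal !evM.
rewrite linearZ /= !phi_nu_e phi_nu ?node_ord // phi_nu_e.
have [c ->] := line (phi v) (node_ord i).
rewrite !linearZ /= !EpolZ (WE2 words) ?node_ord // -/m; lmodf; exact: m0.
Qed.

(** S_k is invertible because (S_k - 1/l) (S_k^2 + m S_k - 1) = 0 has a nonzero constant
    term. *)
Lemma S_inverse k : node n k -> exists S' : 'End(W),
  (forall v, S k (S' v) = v) /\ (forall v, S' (S k v) = v).
Proof.
move=> nk.
have lin_l v : S k (Epol r S k v) = l^-1 *: Epol r S k v.
  by have [c ->] := line v nk; rewrite linearZ /= (Wxx words) // !scalerA mulrC.
have cubic v : l *: (S k (S k (S k v)) + m *: S k (S k v) - S k v)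
    - (S k (S k v) + m *: S k v - v) = 0.
  have <- : S k (Epol r S k v) = S k (S k (S k v)) + m *: S k (S k v) - S k v.
    by rewrite /Epol linearB linearD linearZ.
  by rewrite lin_l scalerA mulfV // scale1r subrr.
(* Read off from the cubic relation above, solved for v. *)
pose S' : 'End(W) := (- l) *: (S k \o S k)%VF + (1 - l * m) *: S k + (l + m) *: \1%VF.
have S'E v : S' v = (- l) *: S k (S k v) + (1 - l * m) *: S k v + (l + m) *: v.
  by rewrite /S' !add_lfunE !scale_lfunE comp_lfunE id_lfunE.
exists S'; split=> v; rewrite S'E.
  rewrite !linearD !linearZ /=; apply/eqP; rewrite -subr_eq0; apply/eqP.
  by rewrite -[RHS]oppr0 -(cubic v); lmod.
by apply/eqP; rewrite -subr_eq0; apply/eqP; rewrite -[RHS]oppr0 -(cubic v); lmod.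
Qed.

End Relations.

(** * The Cohen-Wales representation *)

Section CWFamily.
Variables (F : fieldType) (n : nat).
Hypothesis n2 : (1 < n)%N.
Variables (rho t : F).
Hypothesis rho0 : rho != 0.
Hypothesis indep : forall a b, int_laurent rho a -> int_laurent rho b ->
  a + t * b = 0 -> a = 0 /\ b = 0.
Notation W := (Dn_space F n).
Notation x := (w F n).
Variable tau : nat -> 'End(W).
Hypothesis tauE : forall k, tau k = cw_tau n rho k.

Let rules : tau_rules rho tau.
Proof.
split=> k *; rewrite tauE;
  [exact: tau_simple | exact: tau_down | exact: tau_up | exact: tau_fixed].
Qed.

(** The functional of node k attached to a family indexed by ordinals, where k = i + 1
    corresponds to the ordinal i; it is 0 when k - 1 is not below n. *)
Definition family_fun (T : 'I_n -> Dn_idx n -> F) (k : nat) : {scalar W} :=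
  pairing (fun b => if insub k.-1 is Some i then T i b else 0).

Lemma family_fun_w T (i : 'I_n) h s r (v : valid n s r) (b : Dn_idx n) :
  lo b = s -> hi b = r -> flag b = h -> family_fun T i.+1 (x h s r) = T i b.
Proof. by move=> <- <- <-; rewrite /family_fun /= pairing_w valK. Qed.

Lemma cw_sigma_ofE T (i : 'I_n) v :
  ev (cw_sigma_of rho t T i) v = sigma t tau (family_fun T) i.+1 v.
Proof.
rewrite /cw_sigma_of evD evZ /ev -tauE linext_rank1 scalerA /sigma.
by rewrite /family_fun /= valK.
Qed.

Lemma node_exists k : node n k -> exists i : 'I_n, k = i.+1.
Proof.
by rewrite /node => nk; have kn : (k.-1 < n)%N by [lia]; exists (Ordinal kn) => /=; lia.
Qed.

Lemma family_T_rules T : cw_family rho t T -> T_rules rho tau (family_fun T).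
Proof.
move=> [lT dT [bT cT]]; apply: (necessity n2 rho0 rules indep).
- move=> k h s r /node_exists [i ->] v; have [b [e1 e2 e3]] := idx_of h v.
  by rewrite (family_fun_w T i v e1 e2 e3).
- move=> k nk; have [i ei] := node_exists nk; have [h [s [r [v sm]]]] := simple_ex n2 nk.
  rewrite (xa_simple F n2 nk v sm) ei; have [b [e1 e2 e3]] := idx_of h v.
  rewrite (family_fun_w T i v e1 e2 e3); apply: dT.
  by rewrite root_vecE e1 e2 e3; apply/eqP; rewrite -ei simpleP.
- move=> i j v /node_exists [i' ->] /node_exists [j' ->] adj.
  by rewrite -!cw_sigma_ofE; apply: ev_braid; apply: bT.
move=> i j v /node_exists [i' ->] /node_exists [j' ->] ij nadj.
by rewrite -!cw_sigma_ofE; apply: ev_comm; apply: cT.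
Qed.

(** The explicit table as a family indexed by ordinals. *)
Definition cw_table : 'I_n -> Dn_idx n -> F := fun i b => cwT rho i.+1 (flag b) (lo b) (hi b).

Lemma family_fun_table k : node n k -> family_fun cw_table k =1 cwf n rho k.
Proof. by move=> /node_exists [i ->] v; rewrite /family_fun /= valK. Qed.

Lemma sigma_table k v : node n k -> sigma t tau (family_fun cw_table) k v = sigma t tau (cwf n rho) k v.
Proof. by move=> nk; rewrite /sigma family_fun_table. Qed.

Lemma cw_sigma_of_table (i : 'I_n) v :
  ev (cw_sigma_of rho t cw_table i) v = sigma t tau (cwf n rho) i.+1 v.
Proof. rewrite cw_sigma_ofE; apply: sigma_table; exact: node_ord. Qed.

Lemma cw_table_family : cw_family rho t cw_table.
Proof.
have Trules := cwf_rules n2 rho0 rules.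
split=> [k b|k b e|]; first exact: cwT_laurent.
  have v := idx_valid b; apply: (cwT_simple n2 rho0 (node_ord k) v).
  by rewrite -(simpleP n2 _ (node_ord k) v) -root_vecE e.
apply: (artin_rel_ev cw_sigma_of_table) => i j v.
  move=> adj; have ij := Dn_adj_neq adj.
  exact: (sigma_braid n2 t rho0 rules Trules v (node_ord i) (node_ord j) ij adj).
exact: (sigma_comm n2 t rules Trules v (node_ord i) (node_ord j)).
Qed.

Lemma cw_T_eq : cw_T rho t = cw_table.
Proof.
have uniq T : cw_family rho t T -> T = cw_table.
  move=> fT; apply/boolp.funext => i; apply/boolp.funext => b.
  have := T_rules_unique n2 rho0 rules (family_T_rules fT) (cwf_rules n2 rho0 rules)
    (flag b) (node_ord i) (idx_valid b).
  rewrite (family_fun_w T i (idx_valid b) erefl erefl erefl) => ->.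
  by rewrite cwf_w ?idx_valid.
rewrite /cw_T; case: classical_sets.xgetP => [T _ fT|/(_ cw_table)]; first exact: uniq.
by case; exact: cw_table_family.
Qed.

Lemma cw_sigmaE (i : 'I_n) v :
  ev (cw_sigma rho t i) v = sigma t tau (cwf n rho) i.+1 v.
Proof. rewrite /cw_sigma cw_T_eq; exact: cw_sigma_of_table. Qed.

Lemma cw_sigma_artin : artin_rel *%R (cw_sigma (n := n) rho t).
Proof. by rewrite /cw_sigma cw_T_eq; case: cw_table_family. Qed.

End CWFamily.

(** * Independence of t and r in the field Q(l, r) *)

Lemma rr_neq0 : rr != 0.
Proof. by rewrite /rr tofrac_eq0 polyC_eq0 polyX_eq0. Qed.

Lemma ell_neq0 : ell != 0.
Proof. by rewrite /ell tofrac_eq0 polyX_eq0. Qed.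

Lemma rrX k : rr ^+ k = tofrac ('X^k : {poly rat})%:P.
Proof. by rewrite /rr -tofracXn -polyC_exp. Qed.

Lemma mm_neq0 : mm != 0.
Proof.
rewrite /mm subr_eq0; apply/eqP => e.
have : rr ^+ 2 = 1 by rewrite expr2 -{1}e mulVf // rr_neq0.
move/eqP; rewrite rrX -tofrac1 tofrac_eq -polyC1 (inj_eq polyC_inj) => /eqP /(congr1 (fun p => size (p : {poly rat}))).
by rewrite size_polyXn size_polyC oner_eq0.
Qed.

(** The elements of Q(l, r) of the form c(r) / r^N, with c a polynomial over the
    rationals. *)
Definition clears_rr (a : Qlr) : Prop :=
  exists (c : {poly rat}) (N : nat), a * rr ^+ N = tofrac c%:P.

Lemma clearsD a b : clears_rr a -> clears_rr b -> clears_rr (a + b).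
Proof.
move=> [c [N e]] [d [M e']]; exists (c * 'X^M + d * 'X^N), (N + M)%N.
by rewrite polyCD !polyCM tofracD !tofracM -e -e' -!rrX exprD; ring.
Qed.

Lemma clearsM a b : clears_rr a -> clears_rr b -> clears_rr (a * b).
Proof.
move=> [c [N e]] [d [M e']]; exists (c * d), (N + M)%N.
by rewrite polyCM tofracM -e -e' exprD; ring.
Qed.

Lemma clears_int (z : int) : clears_rr z%:~R.
Proof.
exists z%:~R, 0%N; rewrite expr0 mulr1.
have -> : (z%:~R : {poly rat})%:P = z%:~R by exact: rmorph_int.
by symmetry; exact: rmorph_int.
Qed.

Lemma clears_laurent a : int_laurent rr^-1 a -> clears_rr a.
Proof.
move=> [p [d ->]]; apply: clearsM; last first.
  by exists 'X^d, 0%N; rewrite expr0 mulr1 exprVn invrK rrX.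
elim/poly_ind: p => [|p c IH]; first by rewrite rmorph0 horner0; exact: (clears_int 0).
rewrite rmorphD rmorphM /= map_polyX map_polyC /= !hornerE.
apply: clearsD; last exact: clears_int.
apply: clearsM => //; exists 1, 1%N.
by rewrite expr1 mulVf ?rr_neq0 // polyC1 tofrac1.
Qed.

Lemma clear_denominator (F : fieldType) (e r a b : F) (N M : nat) : e != 0 ->
  a + r ^+ 3 / e * b = 0 -> e * r ^+ M * (a * r ^+ N) + r ^+ 3 * r ^+ N * (b * r ^+ M) = 0.
Proof.
move=> e0 E; transitivity (e * r ^+ N * r ^+ M * (a + r ^+ 3 / e * b)); first by field.
by rewrite E mulr0.
Qed.

Lemma mul_expr_eq0 (F : fieldType) (r a : F) (N : nat) : r != 0 -> a * r ^+ N = 0 -> a = 0.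
Proof.
by move=> r0 /eqP; rewrite mulf_eq0 expf_eq0 (negPf r0) andbF orbF => /eqP.
Qed.

(** After clearing powers of r and multiplying by l, the relation a + t b = 0 reads
    l c(r) + d(r) = 0, and the coefficients of l vanish. *)
Lemma t_indep t : t = rr ^+ 3 / ell -> forall a b,
  int_laurent rr^-1 a -> int_laurent rr^-1 b -> a + t * b = 0 -> a = 0 /\ b = 0.
Proof.
move=> -> a b /clears_laurent [c [N ea]] /clears_laurent [d [M eb]] e.
have r0 := rr_neq0; have l0 := ell_neq0.
have : ell * rr ^+ M * tofrac c%:P + rr ^+ 3 * rr ^+ N * tofrac d%:P = 0.
  by rewrite -ea -eb; apply: clear_denominator.
rewrite /ell !rrX -!tofracM -tofracD -tofrac0 => /eqP; rewrite tofrac_eq => /eqP E.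
have cE : c = 0.
  have := congr1 (fun p : {poly {poly rat}} => p`_1) E.
  rewrite -mulrA -!polyCM coefD coefC /= addr0 coefXM coefC coef0 /= => /eqP.
  by rewrite mulf_eq0 expf_eq0 polyX_eq0 andbF /= => /eqP.
have dE : d = 0.
  have := congr1 (fun p : {poly {poly rat}} => p`_0) E.
  rewrite cE mulr0 add0r -!polyCM coefC coef0 /= => /eqP.
  by rewrite !mulf_eq0 !expf_eq0 !polyX_eq0 !andbF /= => /eqP.
rewrite cE polyC0 tofrac0 in ea; rewrite dE polyC0 tofrac0 in eb.
by split; [apply: mul_expr_eq0 ea | apply: mul_expr_eq0 eb].
Qed.

(** * The equivalence *)

Section Main.
Variables (F : fieldType) (n : nat) (l r : F).
Hypothesis n2 : (1 < n)%N.
Hypothesis r0 : r != 0.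
Hypothesis l0 : l != 0.
Let m : F := r^-1 - r.
Hypothesis m0 : m != 0.
Hypothesis indep : forall a b, int_laurent r^-1 a -> int_laurent r^-1 b ->
  a + r ^+ 3 / l * b = 0 -> a = 0 /\ b = 0.
Notation W := (Dn_space F n).

Lemma escalE (c : F) (A : endo W) : escal W c * A = c *: A.
Proof. by apply: ev_ext => v; rewrite ev_scal evZ. Qed.

Lemma group_rep_conj (G : groupType) (S : G -> endo W) (phi : 'End(W)) :
  cancel phi (phi^-1)%VF -> cancel (phi^-1)%VF phi -> group_rep S ->
  group_rep (fun a => (phi^-1 \o ((S a : 'End(W)) \o phi))%VF : endo W).
Proof.
move=> K K' [S1 SM]; split=> [|a b]; apply: ev_ext => v.
  by rewrite S1 ev1 /ev !comp_lfunE id_lfunE K.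
have SabE u : (S (a * b)%g : 'End(W)) u = (S a : 'End(W)) ((S b : 'End(W)) u).
  by rewrite SM; exact: evM.
by rewrite evM /ev !comp_lfunE SabE K'.
Qed.

Lemma rep_equiv_conj (G : groupType) (S : G -> endo W) (phi : 'End(W)) :
  cancel phi (phi^-1)%VF -> cancel (phi^-1)%VF phi ->
  rep_equiv (fun a => (phi^-1 \o ((S a : 'End(W)) \o phi))%VF : endo W) S.
Proof.
move=> K K'; exists phi; split; first by exists (phi^-1)%VF.
by move=> a; apply/lfunP => v; rewrite !comp_lfunE K'.
Qed.

(** The theorem over any field where t = r^3/l is independent of r. *)
Lemma nu_cohen_wales :
  exists rho : {rmorphism CGW n l m -> endo W},
    [/\ forall c x, rho (c *: x) = c *: rho x,
        forall i : 'I_n, rho (cgw_g l m i) = nu n l r i.+1 &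
        forall t : F, l = r ^+ 3 * t^-1 ->
          exists c : F, c != 0 /\
          exists (R S : artin n -> endo W),
            [/\ group_rep R,
                forall i : 'I_n, R (artin_gen i) = c *: rho (cgw_g l m i),
                cohen_wales_rep t r S &
                rep_equiv R S]].
Proof.
have rho0 : r^-1 != 0 by rewrite invr_eq0.
have [t tE] : exists t, t = r ^+ 3 / l by eexists.
have [tau tauE] : exists tau : nat -> 'End(W), forall k, tau k = cw_tau n r^-1 k.
  by exists (fun k => cw_tau n r^-1 k).
have rules : tau_rules r^-1 tau.
  split=> k *; rewrite tauE;
    [exact: tau_simple | exact: tau_down | exact: tau_up | exact: tau_fixed].
have Trules := cwf_rules n2 rho0 rules.
have [S SE] : exists S : nat -> 'End(W),
    forall k v, S k v = r *: sigma t tau (cwf n r^-1) k v.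
  exists (fun k => r *: (tau k + t *: (linext (fun b : Dn_idx n =>
    cwT r^-1 k (flag b) (lo b) (hi b) *: xa F n k) : 'End(W)))) => k v.
  by rewrite scale_lfunE add_lfunE scale_lfunE linext_rank1 scalerA.
have words := Sr_words n2 r0 l0 tE rules Trules SE.
have line := Sr_line n2 r0 l0 tE rules Trules SE.
have [phiK phiVK] := phi_invK n2 r0 l0 tE rules Trules SE.
have phi_N := phi_nu n2 r0 l0 tE rules Trules SE.
set phi := zmap S (xa F n) in phiK phiVK phi_N.
have rel := nu_cgw m0 words line (can_inj phiK) phi_N.
have [rho [rhoZ rhog _]] := cgw_lift rel.
exists rho; split=> [c x|i|t' et']; [by rewrite rhoZ escalE|exact: rhog|].
have {t' et'}-> : t' = t.
  have t0 : t' != 0 by apply: contra l0 => /eqP t0; rewrite et' t0 invr0 mulr0.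
  by rewrite tE et'; field; rewrite r0 t0.
exists r^-1; split=> //.
have ind : forall a b, int_laurent r^-1 a -> int_laurent r^-1 b ->
  a + t * b = 0 -> a = 0 /\ b = 0 by rewrite tE.
have sE := cw_sigmaE n2 rho0 ind tauE.
have [s' s'K] := fin_all_exists (fun i : 'I_n => S_inverse l0 words line (node_ord i)).
have [|||R [repR genR]] := @artin_rep_lift F W n (cw_sigma r^-1 t) (fun i => r *: s' i).
- exact: (cw_sigma_artin n2 rho0 ind tauE).
- move=> i; apply: ev_ext => v; rewrite evM sE evZ sigmaZ -SE ev1.
  by case: (s'K i) => K1 _; exact: K1.
- move=> i; apply: ev_ext => v; rewrite evM evZ sE -ev_linZ -SE ev1.
  by case: (s'K i) => _ K2; exact: K2.
exists (fun a => (phi^-1 \o ((R a : 'End(W)) \o phi))%VF : endo W), R; split=> //.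
- exact: group_rep_conj.
- move=> i; apply: ev_ext => v; rewrite genR evZ rhog /ev !comp_lfunE.
  apply: (can_inj phiK); rewrite phiVK linearZ /= -/(ev _ _) phi_N ?node_ord // SE.
  by rewrite sE scalerA mulVf // scale1r.
exact: rep_equiv_conj.
Qed.

End Main.

Theorem theorem1 (n : nat) (hn : (4 <= n)%N) :
  exists rho : {rmorphism CGW n ell mm -> endo (Dn_space Qlr n)},
    [/\ forall (c : Qlr) (x : CGW n ell mm), rho (c *: x) = c *: rho x,
        forall i : 'I_n, rho (cgw_g ell mm i) = nu n ell rr i.+1 &
        forall t : Qlr, ell = rr ^+ 3 * t^-1 ->
          exists c : Qlr, c != 0 /\
          exists (R S : artin n -> endo (Dn_space Qlr n)),
            [/\ group_rep R,
                forall i : 'I_n, R (artin_gen i) = c *: rho (cgw_g ell mm i),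
                cohen_wales_rep t rr S &
                rep_equiv R S]].
Proof.
apply: nu_cohen_wales rr_neq0 ell_neq0 mm_neq0 _; first exact: ltn_trans hn.
by move=> a b; apply: t_indep.
Qed.
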